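(* Let $G$ be a connected graph with $n$ vertices, $m$ edges and diameter $d$ (so $n-1\le m\le\binom{n-d}{2}+2n-d-2$). (1) If $d$ is odd and $2n-2-d\le m\le \binom{n-d}{2}+n-1$, then $\sigma_2(G)\ge \frac{7d^3-d+6}{12}+(m-d)\frac{(d+1)^2}{4}$. If $d$ is odd and $m=2n-2-d-k$ or $m=\binom{n-d}{2}+n-1+k$ with $1\le k\le n-d-1$, then $\sigma_2(G)\ge \frac{7d^3-d+6}{12}+(m-d)\frac{(d+1)^2}{4}+k\frac{d+1}{2}$. (2) If $d$ is even with $d\ge4$, let $\mu_j=n-1+\binom j2+2j$ and let $k$ be the least nonnegative integer with $m\le\mu_k$. Then $\sigma_2(G)\ge\frac{7d^3-4d}{12}+(m-d)\frac{d^2}{4}+(n-1-d+k)\frac d2$. (3) If $d=2$, let $\nu_j=\binom j2+j(n-j)$ and let $k\ge0$ be such that $\nu_k\le m<\nu_{k+1}$. Then $\sigma_2(G)\ge\binom k2+2k(n-k)+4(m-\nu_k)$. Each of these lower bounds is attained by some connected $n$-vertex graph with $m$ edges and diameter $d$, except when $d=4$, $m=n$ and $n\ge7$, in which case the minimum of $\sigma_2$ equals the bound in (2) plus $3$.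
   Context: All graphs are finite, simple, undirected. For a connected graph $G$ and $u\in V(G)$, the eccentricity $\varepsilon_G(u)=\max_{v\in V(G)} d_G(u,v)$; the diameter is $\max_u\varepsilon_G(u)$. The second Zagreb eccentricity index is $\sigma_2(G)=\sum_{uv\in E(G)}\varepsilon_G(u)\varepsilon_G(v)$. *)

(* Defs.v *)
From mathcomp Require Import all_boot all_order all_algebra.
Set Implicit Arguments. Unset Strict Implicit. Unset Printing Implicit Defensive.
Import Order.TTheory GRing.Theory Num.Theory.

Section Graphs.
Variable T : finType.
Variable e : rel T.

Definition simple_graph : Prop := symmetric e /\ irreflexive e.

Definition connected_graph : Prop := forall u v : T, connect e u v.

Definition walkb (u v : T) (k : nat) : bool :=
  [exists p : k.-tuple T, path e u p && (last u p == v)].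

(* d(u,v) = least k such that there is a walk of length k from u to v
   (searched among k < #|T|, which suffices in a connected graph) *)
Definition dist (u v : T) : nat := find (walkb u v) (iota 0 #|T|).

Definition ecc (u : T) : nat := \max_(v : T) dist u v.

Definition diam : nat := \max_(u : T) ecc u.

Definition nedges : nat := #|[set p : T * T | e p.1 p.2]| %/ 2.

(* second Zagreb eccentricity index: sum over unordered edges uv of
   ecc(u) ecc(v); the sum over ordered adjacent pairs counts each edge twice *)
Definition sigma2 : nat := (\sum_(u : T) \sum_(v : T | e u v) ecc u * ecc v) %/ 2.

End Graphs.

Definition cgraph_nmd (T : finType) (e : rel T) (n m d : nat) : Prop :=
  [/\ simple_graph e, connected_graph e, #|T| = n, nedges e = m & diam e = d].

Local Open Scope ring_scope.

Definition min_sigma2_is (n m d : nat) (b : rat) : Prop :=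
  (forall (T : finType) (e : rel T), cgraph_nmd e n m d -> b <= (sigma2 e)%:R) /\
  ((exists (T : finType) (e : rel T), cgraph_nmd e n m d) ->
   exists (T : finType) (e : rel T), cgraph_nmd e n m d /\ (sigma2 e)%:R = b).

Definition bound_odd (n m d : nat) : rat :=
  (7 * d%:R ^+ 3 - d%:R + 6) / 12 + (m%:R - d%:R) * (d%:R + 1) ^+ 2 / 4.

Definition mu (n j : nat) : nat := (n - 1 + 'C(j, 2) + 2 * j)%N.

Definition bound_even (n m d k : nat) : rat :=
  (7 * d%:R ^+ 3 - 4 * d%:R) / 12 + (m%:R - d%:R) * d%:R ^+ 2 / 4
  + (n%:R - 1 - d%:R + k%:R) * d%:R / 2.

Definition nu (n j : nat) : nat := ('C(j, 2) + j * (n - j))%N.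

Definition bound_d2 (n m k : nat) : nat := ('C(k, 2) + 2 * k * (n - k) + 4 * (m - nu n k))%N.

(* Main.v *)
(** Lower bound.  Fix a geodesic [P 0, ..., P d] between two vertices at distance
    [d] and let [h] be [d/2] rounded up; every eccentricity is at least [h], and
    that of [P i] is at least [max i (d - i)], which bounds the contribution of the
    geodesic.  An edge off the geodesic costs [h^2], plus [h] for an end which is
    not central (eccentricity larger than [h]).  Every vertex off the geodesic
    owns an edge towards the nearer end of the geodesic, and a vertex at distance
    [h] from both ends owns one edge towards each of them; no edge is owned twice,
    and the next vertex towards one end is not central when the distance left to
    the other end is too large.  Counting owned edges bounds the number of
    non-central ends from below, and counting pairs of central vertices bounds the
    number of the remaining edges from above.

    Extremal graphs.  Attach the remaining vertices to a path [0, ..., d] so that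
    the level function, 1-Lipschitz along edges and equal to [i] at the path vertex
    [i], satisfies [ecc u = max (level u) (d - level u)].  This survives the
    addition of edges between vertices of nearby levels, so all edge numbers
    between two such graphs are realized.

    For [d = 2] the number of dominating vertices determines [sigma2]. *)

Require Import Defs.
From mathcomp Require Import all_boot all_order all_algebra.
From mathcomp Require Import zify ring lra.
Set Implicit Arguments. Unset Strict Implicit. Unset Printing Implicit Defensive.
Import Order.TTheory GRing.Theory Num.Theory.

(** * Distances, ordered pairs of adjacent vertices *)

Section Distance.
Variables (T : finType) (e : rel T).
Hypothesis e_sym : symmetric e.

Lemma walkbP u v k :
  reflect (exists p, [/\ path e u p, last u p = v & size p = k]) (walkb e u v k).
Proof.
apply: (iffP existsP) => [[p /andP[ep /eqP lp]]|[p [ep lp sp]]].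
  by exists p; rewrite ep lp size_tuple.
by exists (tcast sp (in_tuple p)); rewrite val_tcast ep lp eqxx.
Qed.

Lemma walkb0 u : walkb e u u 0.
Proof. by apply/walkbP; exists [::]. Qed.

Lemma walkb1 u v : e u v -> walkb e u v 1.
Proof. by move=> euv; apply/walkbP; exists [:: v]; rewrite /= euv. Qed.

Lemma walkb_cat u v w k l :
  walkb e u v k -> walkb e v w l -> walkb e u w (k + l).
Proof.
move=> /walkbP[p [ep lp <-]] /walkbP[q [eq lq <-]]; apply/walkbP.
by exists (p ++ q); rewrite cat_path last_cat size_cat ep lp eq lq.
Qed.

Lemma walkb_sym u v k : walkb e u v k -> walkb e v u k.
Proof.
move=> /walkbP[p [ep lp <-]]; elim: p u ep lp => [|x p IHp] u /=.
  by move=> _ ->; apply: walkb0.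
case/andP=> eux ep lp; rewrite -addn1; apply: walkb_cat (IHp _ ep lp) _.
by apply: walkb1; rewrite e_sym.
Qed.

Lemma dist_le u v k : walkb e u v k -> dist e u v <= k.
Proof.
move=> uv; rewrite /dist; case: (ltnP k #|T|) => [ltkT|leTk].
  rewrite leqNgt; apply/negP => /(before_find 0).
  by rewrite nth_iota // add0n uv.
by apply: leq_trans leTk; rewrite -{2}(size_iota 0 #|T|) find_size.
Qed.

Lemma walkb_dist u v : connect e u v -> walkb e u v (dist e u v).
Proof.
case/connectP=> p ep ->; case/shortenP: ep => q eq uq _.
have ltqT : size q < #|T| by have := max_card (mem (u :: q)); rewrite (card_uniqP uq).
have hf : has (walkb e u (last u q)) (iota 0 #|T|).
  apply/hasP; exists (size q); first by rewrite mem_iota.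
  by apply/walkbP; exists q.
move: (nth_find 0 hf); rewrite nth_iota //.
by rewrite -[X in _ < X](size_iota 0) -has_find.
Qed.

Lemma dist_refl u : dist e u u = 0.
Proof. by apply/eqP; rewrite -leqn0; apply/dist_le/walkb0. Qed.

(** A function that grows by at most one along each edge bounds distances from below; it is applied
    to level functions. *)
Lemma walkb_lipschitz (f : T -> nat) u v k :
  (forall x y, e x y -> f y <= (f x).+1) -> walkb e u v k -> f v <= f u + k.
Proof.
move=> f_lip /walkbP[p [ep <- <-]]; elim: p u ep => [|x p IHp] u /=.
  by rewrite addn0.
case/andP=> /f_lip fx /IHp fl; apply: leq_trans fl _.
by rewrite addnS -addSn leq_add2r.
Qed.

Lemma dist_le_ecc u v : dist e u v <= ecc e u.
Proof. exact: (leq_bigmax (F := dist e u)). Qed.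

Lemma ecc_le_diam u : ecc e u <= diam e.
Proof. exact: (leq_bigmax (F := ecc e)). Qed.

Lemma dist_le_diam u v : dist e u v <= diam e.
Proof. exact: leq_trans (dist_le_ecc u v) (ecc_le_diam u). Qed.

Lemma ecc_attained u : exists v, dist e u v = ecc e u.
Proof.
have T0 : 0 < #|T| by apply/card_gt0P; exists u.
by case: (@bigop.eq_bigmax _ (dist e u) T0) => v; exists v.
Qed.

Lemma diam_attained : 0 < #|T| -> exists u v, dist e u v = diam e.
Proof.
move=> T0; case: (@bigop.eq_bigmax _ (ecc e) T0) => u uE; rewrite /diam uE.
by case: (ecc_attained u) => v uv; exists u, v.
Qed.

Hypothesis e_conn : connected_graph e.

Lemma dist_triangle u v w : dist e u w <= dist e u v + dist e v w.
Proof.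
by apply: dist_le; apply: walkb_cat; apply: walkb_dist; apply: e_conn.
Qed.

Lemma dist_sym u v : dist e u v = dist e v u.
Proof.
by apply/eqP; rewrite eqn_leq; apply/andP; split;
   apply: dist_le; apply: walkb_sym; apply: walkb_dist; apply: e_conn.
Qed.

Lemma dist_edge u v w : e u v -> dist e u w <= (dist e v w).+1.
Proof.
move=> euv; apply: leq_trans (dist_triangle u v w) _.
by rewrite -add1n leq_add2r; apply/dist_le/walkb1.
Qed.

Lemma dist_gt0 u v : u != v -> 0 < dist e u v.
Proof.
apply: contraNltn; rewrite leqn0 => /eqP d0.
have := walkb_dist (e_conn u v); rewrite d0 => /walkbP[p [_ + /eqP]].
by rewrite size_eq0 => lp /eqP p0; rewrite -lp p0 eqxx.
Qed.

Lemma dist_eq1 u v : u != v -> (dist e u v <= 1) = e u v.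
Proof.
move=> uv; apply/idP/idP => [d1|/walkb1/dist_le//].
have {}d1 : dist e u v = 1 by apply/eqP; rewrite eqn_leq d1 dist_gt0.
have := walkb_dist (e_conn u v); rewrite d1 => /walkbP[[|x [|y p]]] [] //=.
by rewrite andbT => ? <-.
Qed.

Lemma closer_neighbor u v : u != v -> exists w, e u w && (dist e w v < dist e u v).
Proof.
move=> uv; have /walkbP[p [ep lp sp]] := walkb_dist (e_conn u v).
have := dist_gt0 uv; rewrite -sp.
case: p ep lp sp => //= w p /andP[euw ep] lp sp _; exists w; rewrite euw ltnS.
by apply: dist_le; apply/walkbP; exists p.
Qed.

Lemma geodesicP u v : exists P : nat -> T,
  [/\ P 0 = u, P (dist e u v) = v & forall i, i < dist e u v -> e (P i) (P i.+1)].
Proof.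
have /walkbP[p [ep lp sp]] := walkb_dist (e_conn u v).
exists (nth u (u :: p)); rewrite -sp; split=> //.
  by rewrite -lp -nth_last /=; case: p {ep lp sp}.
by move=> i /(pathP u ep).
Qed.

End Distance.

Section OrderedPairs.
Variables (T : finType).
Implicit Types (A : {set T * T}) (w : T -> T -> nat).

Definition sym_pairs A := forall u v, ((u, v) \in A) = ((v, u) \in A).

Definition swap (p : T * T) := (p.2, p.1).

Lemma swapK : involutive swap. Proof. by case. Qed.

(** The owned pairs and their swaps are disjoint subsets of [A], by antisymmetry of [O], and carry
    equal weight, by symmetry of [w]. This turns an assignment of edges to vertices into a lower
    bound on a sum over ordered pairs. *)
Lemma sum_owned A (O : rel T) w :
  sym_pairs A -> (forall u v, w u v = w v u) ->
  (forall u v, O u v -> (u, v) \in A) -> (forall u v, O u v -> ~~ O v u) ->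
  2 * (\sum_u \sum_(v | O u v) w u v) <= \sum_(p in A) w p.1 p.2.
Proof.
move=> A_sym w_sym OA O_anti; rewrite pair_big_dep /=.
rewrite [leqRHS](bigID (fun p => O p.1 p.2)) /=.
rewrite mul2n -addnn; apply: leq_add.
  rewrite [leqRHS](eq_bigl (fun p => O p.1 p.2)) // => -[u v] /=.
  by case Ouv: (O u v); rewrite ?andbF // OA.
rewrite [leqRHS](bigID (fun p => O p.2 p.1)) /=.
apply: leq_trans (leq_addr _ _).
rewrite [leqLHS](reindex_inj (inv_inj swapK)) /=.
rewrite [leqRHS](eq_bigl (fun p => O p.2 p.1)) => [|[u v] /=].
  by apply: eq_leq; apply: eq_bigr => p _; apply: w_sym.
by case Ovu: (O v u); rewrite ?andbF // A_sym OA //= O_anti.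
Qed.

(** Swapping exchanges the pairs increasing in the enumeration of [T] with the decreasing ones.
    Hence the divisions by 2 in [nedges] and [sigma2] are exact, and all later counts are made on
    ordered pairs. *)
Lemma sum_sym_even A w :
  sym_pairs A -> (forall u v, w u v = w v u) -> (forall u, (u, u) \notin A) ->
  ~~ odd (\sum_(p in A) w p.1 p.2).
Proof.
move=> A_sym w_sym A_irr.
pose lt (p : T * T) := enum_rank p.1 < enum_rank p.2.
rewrite (bigID lt) /= [X in _ + X](reindex_inj (inv_inj swapK)) /=.
rewrite [X in _ + X](eq_big (fun p => (p \in A) && lt p) (fun p => w p.1 p.2)).
- by rewrite addnn odd_double.
- case=> u v /=; rewrite A_sym; case uvA: ((u, v) \in A) => //=.
  rewrite /lt /= -leqNgt leq_eqVlt orb_idl // => /eqP/val_inj/enum_rank_inj uv.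
  by rewrite uv (negPf (A_irr v)) in uvA.
- by move=> p _; apply: w_sym.
Qed.

Lemma card_sym_even A :
  sym_pairs A -> (forall u, (u, u) \notin A) -> ~~ odd #|A|.
Proof. by move=> *; rewrite -sum1_card; apply: (sum_sym_even (w := fun _ _ => 1)). Qed.

End OrderedPairs.

Section EdgeSums.
Variables (T : finType) (e : rel T).
Hypothesis e_simple : simple_graph e.

Definition arcs : {set T * T} := [set p | e p.1 p.2].

Lemma in_arcs u v : ((u, v) \in arcs) = e u v.
Proof. by rewrite inE. Qed.

Lemma arcs_sym : sym_pairs arcs.
Proof. by move=> u v; rewrite !in_arcs e_simple.1. Qed.

Lemma arcs_irr u : (u, u) \notin arcs.
Proof. by rewrite in_arcs e_simple.2. Qed.

Lemma nedgesE : nedges e * 2 = #|arcs|.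
Proof. by rewrite /nedges divnK // dvdn2; apply: card_sym_even arcs_sym arcs_irr. Qed.

Lemma sigma2E : sigma2 e * 2 = \sum_(p in arcs) ecc e p.1 * ecc e p.2.
Proof.
rewrite /sigma2 pair_big_dep /= (eq_bigl (mem arcs)) => [|p]; last by rewrite /= inE.
rewrite divnK // dvdn2.
apply: (sum_sym_even (w := fun u v => ecc e u * ecc e v) arcs_sym) arcs_irr.
by move=> u v; apply: mulnC.
Qed.

End EdgeSums.

Lemma bin2_double n : 'C(n, 2) * 2 = n * (n - 1).
Proof.
case: n => // n; rewrite bin2 /= subn1 muln2.
by have := odd_double_half (n.+1 * n); rewrite oddM /= andNb add0n.
Qed.

(** * Counting edges off a geodesic *)

Lemma path_arcs_sum d (g : nat -> nat -> nat) :
  \sum_(i < d.+1) \sum_(j < d.+1 | (j == i.+1 :> nat) || (i == j.+1 :> nat)) g i j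
  = \sum_(i < d) (g i i.+1 + g i.+1 i).
Proof.
have half (G : nat -> nat -> nat) :
    \sum_(i < d.+1) \sum_(j < d.+1 | j == i.+1 :> nat) G i j = \sum_(i < d) G i i.+1.
  rewrite big_ord_recr /= [X in _ + X]big1 ?addn0 => [|j /eqP jd]; last first.
    by have := ltn_ord j; rewrite jd ltnn.
  apply: eq_bigr => i _; have ltid : i.+1 < d.+1 by rewrite ltnS.
  rewrite (eq_bigl (pred1 (Ordinal ltid))) ?big_pred1_eq //.
rewrite big_split /= -half -(half (fun i j => g j i)) [X in _ + X](exchange_big_dep xpredT) //=.
rewrite -big_split /=; apply: eq_bigr => i _.
rewrite [LHS](bigID (fun j : 'I__ => j == i.+1 :> nat)) /=.
by congr addn; apply: eq_bigl => j; lia.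
Qed.

Lemma card_offdiag (T : finType) (X : {set T}) :
  #|[set p : T * T | [&& p.1 \in X, p.2 \in X & p.1 != p.2]]| = #|X| * (#|X| - 1).
Proof.
rewrite -sum1_card (eq_bigl (fun p => (p.1 \in X) && ((p.2 \in X) && (p.1 != p.2))));
  last by move=> p; rewrite inE.
rewrite -(pair_big_dep (mem X) (fun u v => (v \in X) && (u != v)) (fun _ _ => 1)) /=.
rewrite -sum_nat_const; apply: eq_bigr => u uX.
rewrite sum1_card (cardsD1 u X) uX add1n subn1 /=.
by apply: eq_card => v; rewrite !inE unfold_in andbC eq_sym.
Qed.

(** The eccentricity of the vertex [i] in the path [0, ..., d]; accordingly [path_cost d] is the
    index of that path. *)
Definition maxdist d i := maxn i (d - i).

Definition path_cost d := \sum_(i < d) maxdist d i * maxdist d i.+1.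

Section Geodesic.
Variables (T : finType) (e : rel T).
Hypotheses (e_simple : simple_graph e) (e_conn : connected_graph e).
Variables (v0 vd : T) (P : nat -> T).
Let d := dist e v0 vd.
Hypotheses (P0 : P 0 = v0) (Pd : P d = vd).
Hypothesis P_edge : forall i, i < d -> e (P i) (P i.+1).

Let e_sym := e_simple.1.
Let a u := dist e u v0.
Let b u := dist e u vd.

Lemma le_dist_ends u : d <= a u + b u.
Proof. by rewrite /a (dist_sym e_sym e_conn u v0); apply: dist_triangle. Qed.

(** Walking along [P] from either end gives both upper bounds, and [le_dist_ends] forces
    equality. *)
Lemma dist_geodesic i : i <= d -> a (P i) = i /\ b (P i) = d - i.
Proof.
move=> led; have le_a j : j <= d -> a (P j) <= j.
  elim: j => [|j IHj] jd; first by rewrite P0 /a dist_refl.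
  apply: leq_trans (dist_edge e_conn v0 (_ : e _ (P j))) _.
    by rewrite e_sym P_edge.
  by rewrite ltnS IHj // ltnW.
have le_b k : k <= d -> b (P (d - k)) <= k.
  elim: k => [|k IHk] kd; first by rewrite subn0 Pd /b dist_refl.
  apply: leq_trans (dist_edge e_conn vd (P_edge _)) _; first by lia.
  by rewrite -subSn // subSS ltnS IHk // ltnW.
have := le_a i led; have := le_b (d - i) (leq_subr i d).
by rewrite subKn //; have := le_dist_ends (P i); lia.
Qed.

Lemma geodesic_inj i j : i <= d -> j <= d -> P i = P j -> i = j.
Proof. by move=> /dist_geodesic[ai _] /dist_geodesic[aj _] Pij; rewrite -ai Pij. Qed.

Lemma geodesic_adj i j : i <= d -> j <= d ->
  e (P i) (P j) = (j == i.+1) || (i == j.+1).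
Proof.
move=> id jd; apply/idP/idP => [eij|/orP[] /eqP ij]; last 1 first.
- by rewrite ij e_sym P_edge // -ij.
- have [ai _] := dist_geodesic id; have [aj _] := dist_geodesic jd.
  have : i != j by apply: contraTneq eij => ->; rewrite e_simple.2.
  have := dist_edge e_conn v0 eij; rewrite e_sym in eij.
  have := dist_edge e_conn v0 eij; rewrite -!/(a _); lia.
- by rewrite ij P_edge // -ij.
Qed.

Definition spine : {set T} := [set P (i : 'I_d.+1) | i : 'I_d.+1].

Lemma spineP u : reflect (exists2 i, i <= d & u = P i) (u \in spine).
Proof.
apply: (iffP imsetP) => [[i _ ->]|[i id ->]]; first by exists i; rewrite // -ltnS.
by exists (inord i); rewrite ?inordK.
Qed.

Lemma card_spine : #|spine| = d.+1.
Proof.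
rewrite card_imset ?card_ord // => i j /geodesic_inj ij.
by apply/val_inj/ij; rewrite -ltnS.
Qed.

(** The geodesic is an induced path ([geodesic_adj]), so exactly its own [2 * d] ordered pairs are
    left out. *)
Definition off_arcs : {set T * T} :=
  [set p in arcs e | ~~ ((p.1 \in spine) && (p.2 \in spine))].

Lemma in_off_arcs u v :
  ((u, v) \in off_arcs) = e u v && ~~ ((u \in spine) && (v \in spine)).
Proof. by rewrite !inE. Qed.

Lemma off_arcs_sym : sym_pairs off_arcs.
Proof. by move=> u v; rewrite !in_off_arcs e_sym [(u \in _) && _]andbC. Qed.

Lemma arcs_sum_split (w : T -> T -> nat) :
  \sum_(p in arcs e) w p.1 p.2 =
  \sum_(i < d) (w (P i) (P i.+1) + w (P i.+1) (P i)) + \sum_(p in off_arcs) w p.1 p.2.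
Proof.
rewrite (bigID (fun p => (p.1 \in spine) && (p.2 \in spine))) /=; congr addn; last first.
  by apply: eq_bigl => p; rewrite !inE.
rewrite (eq_bigl (fun p => (p.1 \in spine) && ((p.2 \in spine) && e p.1 p.2))); last first.
  by move=> p; rewrite !inE andbC andbA.
rewrite -(pair_big_dep (mem spine) (fun u v => (v \in spine) && e u v)) /=.
have inj : {in 'I_d.+1 &, injective (fun i : 'I_d.+1 => P i)}.
  by move=> i j _ _ /geodesic_inj ij; apply/val_inj/ij; rewrite -ltnS.
rewrite big_imset //= -(path_arcs_sum d (fun i j => w (P i) (P j))).
apply: eq_bigr => i _; rewrite big_mkcondr /= big_imset //= -big_mkcondr /=.
by apply: eq_bigl => j; rewrite geodesic_adj // -ltnS.
Qed.

Lemma card_arcs_split : #|arcs e| = d * 2 + #|off_arcs|.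
Proof.
rewrite -!sum1_card (arcs_sum_split (fun _ _ => 1)).
by rewrite big_const_ord iter_addn_0; lia.
Qed.

Lemma maxdist_le_ecc i : i <= d -> maxdist d i <= ecc e (P i).
Proof.
case/dist_geodesic=> ai bi; rewrite geq_max -{1}ai -bi; apply/andP.
by split; apply: dist_le_ecc.
Qed.

Lemma path_cost_le :
  path_cost d * 2 <= \sum_(i < d) (ecc e (P i) * ecc e (P i.+1) + ecc e (P i.+1) * ecc e (P i)).
Proof.
rewrite muln2 -addnn big_split /=; apply: leq_add; apply: leq_sum => i _.
  by apply: leq_mul; apply: maxdist_le_ecc; rewrite // ltnW.
by rewrite mulnC; apply: leq_mul; apply: maxdist_le_ecc; rewrite // ltnW.
Qed.

(** In a connected graph the default [u] is returned only at the end [v0] itself, and for [par1]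
    only at [vd]. *)
Definition par0 u := odflt u [pick v | e u v && (a v < a u)].
Definition par1 u := odflt u [pick v | e u v && (b v < b u)].

Lemma par0P u : u \notin spine -> e u (par0 u) /\ a (par0 u) < a u.
Proof.
move=> uP; have : u != v0.
  by apply: contraNneq uP => ->; apply/spineP; exists 0.
case/(closer_neighbor e_conn) => w uw; rewrite /par0; case: pickP => [v /andP[]//|].
by move/(_ w); rewrite uw.
Qed.

Lemma par1P u : u \notin spine -> e u (par1 u) /\ b (par1 u) < b u.
Proof.
move=> uP; have : u != vd.
  by apply: contraNneq uP => ->; apply/spineP; exists d.
case/(closer_neighbor e_conn) => w uw; rewrite /par1; case: pickP => [v /andP[]//|].
by move/(_ w); rewrite uw.
Qed.

(** A vertex at distance [a u] from [v0] is adjacent to at most three geodesic vertices, those at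
    positions [a u - 1], [a u], [a u + 1]. With [t] vertices off the geodesic this leaves
    [t * (t - 1)] ordered pairs among them and [2 * 3 * t] mixed ones. It caps the number of edges
    for a given [n] and [d]. *)
Lemma off_arcs_le : #|off_arcs| <= #|~: spine| ^ 2 + 5 * #|~: spine|.
Proof.
pose t := #|~: spine|.
pose N := [set p : T * T | [&& e p.1 p.2, p.1 \notin spine & p.2 \in spine]].
have leN : #|N| <= 3 * t.
  rewrite -sum1_card (eq_bigl (fun p => (p.1 \in ~: spine) && ((p.2 \in spine) && e p.1 p.2)));
    last by move=> p; rewrite !inE; case: (e _ _); rewrite ?andbF ?andbT.
  rewrite -(pair_big_dep (mem (~: spine)) (fun u v => (v \in spine) && e u v) (fun _ _ => 1)) /=.
  rewrite mulnC -sum_nat_const; apply: leq_sum => u uP.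
  rewrite sum1dep_card; apply: leq_trans (_ : #|[set P (a u).-1; P (a u); P (a u).+1]| <= 3);
    last by rewrite (leq_trans (leq_card_setU _ _)) // cards1 addn1 ltnS cards2; case: (_ != _).
  apply/subset_leq_card/subsetP => v; rewrite inE => /andP[/spineP[i id vE] euv].
  have [ai _] := dist_geodesic id; rewrite vE in euv.
  have := dist_edge e_conn v0 euv; rewrite e_sym in euv.
  have := dist_edge e_conn v0 euv; rewrite -!/(a _) ai => le1 le2.
  have : [|| i == (a u).-1, i == a u | i == (a u).+1] by lia.
  by rewrite !inE vE => /or3P[] /eqP<-; rewrite eqxx ?orbT.
pose W := [set p : T * T | [&& p.1 \in ~: spine, p.2 \in ~: spine & p.1 != p.2]].
have FE : off_arcs \subset W :|: (N :|: [set swap p | p in N]).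
  apply/subsetP => -[u v]; rewrite in_off_arcs => /andP[euv uv].
  rewrite in_setU in_setU; case: (boolP (u \in spine)) uv => /= uP vP.
    apply/orP; right; apply/orP; right; apply/imsetP; exists (v, u) => //.
    by rewrite inE /= e_sym euv uP vP.
  case: (boolP (v \in spine)) => vP'; last first.
    rewrite !inE /= uP vP' /=.
    by have -> : u != v by apply: contraTneq euv => ->; rewrite e_simple.2.
  by rewrite [in X in _ || (X || _)]inE /= euv uP vP' orbT.
apply: leq_trans (subset_leq_card FE) _.
apply: leq_trans (leq_card_setU _ _) _; rewrite card_offdiag -/t.
have := (leq_card_setU N [set swap p | p in N]).1.
rewrite card_imset; last exact: (inv_inj (@swapK T)).
rewrite -mulnn; move: leN; rewrite -/t; case: t => [|t]; rewrite ?subn1 /=;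
  move: #|_ :|: _| #|N| => x y leN leU; nia.
Qed.

(** * Owned edges and central vertices *)

Variable h : nat.
Hypotheses (le_h_d : h * 2 <= d.+1) (le_d_h : d <= h * 2).

(** The test involves [b] alone, so that after a step towards [vd] the next owned step also leads
    towards [vd]; [own_anti] rests on this. *)
Definition par u := if b u < h then par1 u else par0 u.
Definition midway u := (a u == h) && (b u == h).
Definition own : rel T :=
  fun u v => (u \notin spine) && ((v == par u) || midway u && (v == par1 u)).

Lemma own_off_arc u v : own u v -> (u, v) \in off_arcs.
Proof.
case/andP=> uP uv; rewrite in_off_arcs (negPf uP) andbT.
have [e0 _] := par0P uP; have [e1 _] := par1P uP.
by case/orP: uv => [|/andP[_]] /eqP-> //; rewrite /par; case: ifP.
Qed.

(** A step towards [vd] starts at [b] at most [h], hence ends at [b] less than [h], where only steps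
    towards [vd] are owned. Thus an edge owned from both ends would be a step towards the same end
    in both directions, and one distance would decrease twice around a cycle of length two. *)
Lemma own_anti u v : own u v -> ~~ own v u.
Proof.
case/andP=> uP uv; apply/negP => /andP[vP vu].
have [_ a_u] := par0P uP; have [_ b_u] := par1P uP.
have [_ a_v] := par0P vP; have [_ b_v] := par1P vP.
case/orP: uv => [|/andP[/andP[/eqP au /eqP bu]]] /eqP;
case/orP: vu => [|/andP[/andP[/eqP av /eqP bv]]] /eqP; rewrite /par.
- by case: ifP; case: ifP => bu bv uE vE; rewrite -?uE -?vE in a_u b_u a_v b_v; lia.
- by case: ifP => bu uE vE; rewrite -?uE -?vE in a_u b_u a_v b_v; lia.
- by case: ifP => bv uE vE; rewrite -?uE -?vE in a_u b_u a_v b_v; lia.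
- by move=> uE vE; rewrite -?uE -?vE in a_u b_u a_v b_v; lia.
Qed.

(** A common parent would be at distance less than [h] from both ends, although these are at least
    [2 * h - 1] apart. *)
Lemma midway_par u : u \notin spine -> midway u -> par u != par1 u.
Proof.
move=> uP /andP[/eqP au /eqP bu]; rewrite /par bu ltnn.
have [_ a_u] := par0P uP; have [_ b_u] := par1P uP.
by apply/eqP => pE; rewrite -pE in b_u; have := le_dist_ends (par0 u); lia.
Qed.

Lemma own_weight (w : T -> T -> nat) : (forall u v, w u v = w v u) ->
  2 * (\sum_(u in ~: spine) (w u (par u) + midway u * w u (par1 u)))
  <= \sum_(p in off_arcs) w p.1 p.2.
Proof.
move=> w_sym; apply: leq_trans (sum_owned off_arcs_sym w_sym own_off_arc own_anti).
rewrite leq_mul2l /= big_mkcond /=; apply: leq_sum => u _.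
rewrite inE; case: ifP => // uP; rewrite /own uP /=.
case mu: (midway u); last first.
  by rewrite mul0n addn0 /= (eq_bigl (pred1 (par u))) ?big_pred1_eq // => v; rewrite orbF.
rewrite mul1n (bigD1 (par u)) ?eqxx //= leq_add2l (bigD1 (par1 u)) ?leq_addr //=.
by rewrite eqxx orbT eq_sym midway_par.
Qed.

(** By [le_h_ecc] these are the vertices whose eccentricity is exactly [h], the least value
    possible. *)
Definition central := [set u | ecc e u <= h].
Definition bad u v := ~~ ((u \in central) && (v \in central)).

Lemma bad_sym u v : bad u v = bad v u.
Proof. by rewrite /bad andbC. Qed.

Lemma central_dist u : u \in central -> a u <= h /\ b u <= h.
Proof. by rewrite inE => uh; split; apply: leq_trans uh; apply: dist_le_ecc. Qed.

Lemma le_h_ecc u : h <= ecc e u.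
Proof.
have := le_dist_ends u; have := dist_le_ecc e u v0; have := dist_le_ecc e u vd.
by rewrite -/(a u) -/(b u); lia.
Qed.

Lemma par0_central u : u \notin spine -> a u + h <= d -> par0 u \notin central.
Proof.
move=> /par0P[_ au] ad; apply/negP => /central_dist[_ bp].
by have := le_dist_ends (par0 u); lia.
Qed.

Lemma par1_central u : u \notin spine -> b u + h <= d -> par1 u \notin central.
Proof.
move=> /par1P[_ bu] bd; apply/negP => /central_dist[ap _].
by have := le_dist_ends (par1 u); lia.
Qed.

Definition peripheral_ends u v := (u \notin central) + (v \notin central).

Lemma bad_le_peripheral u v : bad u v <= peripheral_ends u v.
Proof. by rewrite /bad /peripheral_ends; case: (u \in _); case: (v \in _). Qed.

(** Each vertex off the geodesic owns total weight at least 2: a midway vertex owns two edges, and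
    any other owns an edge that is bad. Indeed a central vertex that is not midway has [a] or [b]
    below [h], so its parent on that side is too far from the other end to be central. *)
Lemma odd_weight : d.+1 = h * 2 ->
  4 * #|~: spine| <= #|off_arcs| + \sum_(p in off_arcs) bad p.1 p.2.
Proof.
move=> d_odd; rewrite -[#|off_arcs|]sum1_card -big_split /=.
have := own_weight (w := fun u v => 1 + bad u v) _.
move/(_ (fun u v => congr1 (fun x : bool => 1 + x) (bad_sym u v))).
apply: leq_trans; rewrite (_ : 4 = 2 * 2) // -mulnA leq_mul2l /= mulnC -sum_nat_const.
apply: leq_sum => u; rewrite inE => uP.
case: (boolP (midway u)) => mu; first by rewrite mul1n; lia.
suff -> : bad u (par u) by lia.
rewrite /bad negb_and; case: (boolP (u \in central)) => //= /central_dist[au bu].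
rewrite /par; case: ifP => bh; first by rewrite par1_central //; lia.
by rewrite par0_central //; move: mu; rewrite /midway; lia.
Qed.

(** A non-central vertex makes its owned edge bad. A central one satisfies [a = b = h], so it is
    midway, and both of its parents are non-central: it owns two bad edges. *)
Lemma even_weight : d = h * 2 ->
  2 * (#|~: spine| + #|central :\: spine|) <= \sum_(p in off_arcs) bad p.1 p.2.
Proof.
move=> d_even.
have := own_weight (w := bad) (fun u v => congr1 nat_of_bool (bad_sym u v)).
apply: leq_trans; rewrite leq_mul2l /= -[#|~: _|]sum1_card -[#|_ :\: _|]sum1_card.
rewrite [X in _ + X](eq_bigl (fun u => (u \in ~: spine) && (u \in central))); last first.
  by move=> u; rewrite !inE.
rewrite big_mkcondr -big_split /=; apply: leq_sum => u; rewrite inE => uP.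
case: ifP => uC; last by rewrite /bad uC.
have [au bu] := central_dist uC; have abu := le_dist_ends u.
have -> : midway u by rewrite /midway; lia.
have -> : bad u (par1 u) by rewrite /bad uC /= par1_central //; lia.
suff -> : bad u (par u) by [].
by rewrite /bad uC /par ifN /= ?par0_central //; lia.
Qed.

Lemma off_arcs_bad : #|off_arcs| = \sum_(p in off_arcs) bad p.1 p.2 +
  #|[set p in off_arcs | ~~ bad p.1 p.2]|.
Proof.
rewrite -!sum1_card (bigID (fun p => bad p.1 p.2)) /=; congr addn.
  rewrite big_mkcond [RHS]big_mkcond /=; apply: eq_bigr => p _.
  by case: (p \in _) => //=; case: (bad _ _).
by apply: eq_bigl => p; rewrite [RHS]inE.
Qed.

(** Central vertices lie off the geodesic or are one of its two middle vertices. With [t] vertices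
    off it this gives [(t + 2) * (t + 1)] ordered pairs, of which the two orientations of the middle
    geodesic edge ([Y]) are not off the geodesic. *)
Lemma odd_good : d.+1 = h * 2 ->
  #|[set p in off_arcs | ~~ bad p.1 p.2]| <= #|~: spine| ^ 2 + 3 * #|~: spine|.
Proof.
move=> d_odd.
pose X := (~: spine) :|: [set P h.-1; P h].
pose G := [set p in off_arcs | ~~ bad p.1 p.2].
pose Y := [set (P h.-1, P h); (P h, P h.-1)].
have hd : P h.-1 != P h by apply/eqP => /geodesic_inj; lia.
have sp i : i <= d -> P i \in spine by move=> id; apply/spineP; exists i.
have GX : G :|: Y \subset [set p | [&& p.1 \in X, p.2 \in X & p.1 != p.2]].
  apply/subsetP => -[u v]; rewrite inE => /orP[]; last first.
    by rewrite !inE => /orP[] /eqP[-> ->] /=; rewrite !eqxx ?orbT //= ?hd // eq_sym hd.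
  rewrite inE in_off_arcs /= negbK => /andP[/andP[euv _] /andP[uC vC]].
  rewrite inE /=; have -> : u != v by apply: contraTneq euv => ->; rewrite e_simple.2.
  have CX z : z \in central -> z \in X.
    move=> /central_dist[az bz]; rewrite 2!inE; case: (boolP (z \in spine)) => //=.
    case/spineP=> i id zE; have [ai bi] := dist_geodesic id.
    have : (i == h.-1) || (i == h) by rewrite zE in az bz; lia.
    by rewrite zE !inE => /orP[] /eqP->; rewrite eqxx ?orbT.
  by rewrite !CX.
have := subset_leq_card GX; rewrite card_offdiag cardsU.
have -> : G :&: Y = set0.
  apply/setP => -[u v]; rewrite in_setI in_set0; apply/negP => /andP[].
  rewrite inE in_off_arcs !inE => /andP[/andP[_ uv] _] /orP[] /eqP[uE vE];
  by rewrite uE vE !sp // in uv; lia.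
have -> : #|Y| = 2 by rewrite cards2 xpair_eqE negb_and hd.
have : #|X| <= #|~: spine| + 2.
  by rewrite cardsU cards2 hd leq_subr.
rewrite cards0 -/G; nia.
Qed.

(** The geodesic has only one vertex that can be central, [P h], so good pairs live on at most
    [s + 1] vertices. *)
Lemma even_good : d = h * 2 ->
  #|[set p in off_arcs | ~~ bad p.1 p.2]|
  <= #|central :\: spine| * #|central :\: spine|.+1.
Proof.
move=> d_even; set s := #|_ :\: _|.
pose X := P h |: (central :\: spine).
have sX : #|X| <= s.+1 by rewrite cardsU1 -/s; case: (_ \notin _).
apply: (@leq_trans (#|X| * (#|X| - 1))); last by nia.
rewrite -card_offdiag; apply/subset_leq_card/subsetP => -[u v].
rewrite inE in_off_arcs /= negbK => /andP[/andP[euv _] /andP[uC vC]].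
rewrite inE /=; have -> : u != v by apply: contraTneq euv => ->; rewrite e_simple.2.
have CX z : z \in central -> z \in X.
  move=> zC; have [az bz] := central_dist zC; rewrite 2!inE in_setD zC andbT.
  case: (boolP (z \in spine)) => [|_]; last by rewrite orbT.
  case/spineP=> i id zE; have [ai bi] := dist_geodesic id.
  suff /eqP<- : i == h by rewrite zE eqxx.
  by rewrite zE in az bz; lia.
by rewrite !CX.
Qed.

Lemma sigma2_lower (c : T -> T -> nat) :
  (forall u v, (u, v) \in off_arcs -> h ^ 2 + h * c u v <= ecc e u * ecc e v) ->
  path_cost d * 2 + (#|off_arcs| * h ^ 2 + h * \sum_(p in off_arcs) c p.1 p.2)
  <= sigma2 e * 2.
Proof.
move=> c_le; rewrite sigma2E // (arcs_sum_split (fun u v => ecc e u * ecc e v)).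
apply: leq_add path_cost_le _.
by rewrite -sum_nat_const big_distrr -big_split /=; apply: leq_sum => -[u v]; apply: c_le.
Qed.

Lemma sigma2_lower_bad :
  path_cost d * 2 + (#|off_arcs| * h ^ 2 + h * \sum_(p in off_arcs) bad p.1 p.2)
  <= sigma2 e * 2.
Proof.
apply: (@sigma2_lower (fun u v => bad u v)) => u v _; rewrite /bad !inE.
have := le_h_ecc u; have := le_h_ecc v.
by case: (leqP (ecc e u) h); case: (leqP (ecc e v) h) => /=; nia.
Qed.

(** Refines [sigma2_lower_bad]: an edge with two non-central ends costs at least [(h + 1) ^ 2],
    hence [h ^ 2] plus [h] for each end. *)
Lemma sigma2_lower_peripheral :
  path_cost d * 2 + (#|off_arcs| * h ^ 2 + h * \sum_(p in off_arcs) peripheral_ends p.1 p.2)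
  <= sigma2 e * 2.
Proof.
apply: sigma2_lower => u v _; rewrite /peripheral_ends !inE.
have := le_h_ecc u; have := le_h_ecc v.
by case: (leqP (ecc e u) h); case: (leqP (ecc e v) h) => /=; nia.
Qed.

End Geodesic.

(** * Closed form of the cost of a path *)

Lemma sum_consecutive c k :
  3 * \sum_(i < k) (c + i) * (c + i).+1 + c ^ 3 + (c + k) = (c + k) ^ 3 + c.
Proof.
elim: k => [|k IHk]; first by rewrite big_ord0; lia.
by rewrite big_ord_recr /=; move: IHk; set S := \sum_(_ < _) _; nia.
Qed.

Lemma sum_consecutive_down c k : k <= c ->
  3 * \sum_(i < k) (c - i) * (c - i.+1) + (c - k) ^ 3 + c = c ^ 3 + (c - k).
Proof.
elim: k => [|k IHk] kc; first by rewrite big_ord0; lia.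
rewrite big_ord_recr /=; move: (IHk (ltnW kc)); set S := \sum_(_ < _) _.
have -> : c - k = (c - k.+1).+1 by lia.
by move: (c - k.+1) => x; nia.
Qed.

(** The eccentricities fall to [r + 1], stay there across the middle edge, then rise; on both slopes
    [3 * x * (x + 1)] telescopes as a difference of values of [x ^ 3 - x]. *)
Lemma path_cost_odd r :
  12 * path_cost (r * 2).+1 + (r * 2).+1 = 7 * (r * 2).+1 ^ 3 + 6.
Proof.
rewrite /path_cost; have -> : (r * 2).+1 = r.+1 + r by lia.
rewrite big_split_ord big_ord_recr /=.
rewrite (eq_bigr (fun i : 'I_r => (r.*2.+1 - i) * (r.*2.+1 - i.+1))); last first.
  by move=> i _; have := ltn_ord i; rewrite /maxdist /= => lt_i; congr muln; lia.
have -> : \sum_(i < r) maxdist (r.+1 + r) (r.+1 + i) * maxdist (r.+1 + r) (r.+1 + i).+1 =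
          \sum_(i < r) (r.+1 + i) * (r.+1 + i).+1.
  by apply: eq_bigr => i _; have := ltn_ord i; rewrite /maxdist /= => lt_i; congr muln; lia.
have -> : maxdist (r.+1 + r) r * maxdist (r.+1 + r) r.+1 = r.+1 ^ 2.
  by rewrite /maxdist -mulnn; congr (_ * _); lia.
have := sum_consecutive r.+1 r; have := @sum_consecutive_down r.*2.+1 r.
have -> : r.*2.+1 - r = r.+1 by lia.
set S1 := \sum_(_ < _) _; set S2 := \sum_(_ < _) _.
by move=> /(_ ltac:(lia)); rewrite -!mul2n; nia.
Qed.

Lemma path_cost_even r :
  12 * path_cost (r * 2) + 4 * (r * 2) = 7 * (r * 2) ^ 3.
Proof.
rewrite /path_cost; have -> : r * 2 = r + r by lia.
rewrite big_split_ord /=.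
rewrite (eq_bigr (fun i : 'I_r => (r.*2 - i) * (r.*2 - i.+1))); last first.
  by move=> i _; have := ltn_ord i; rewrite /maxdist /= => lt_i; congr muln; lia.
have -> : \sum_(i < r) maxdist (r + r) (r + i) * maxdist (r + r) (r + i).+1 =
          \sum_(i < r) (r + i) * (r + i).+1.
  by apply: eq_bigr => i _; have := ltn_ord i; rewrite /maxdist /= => lt_i; congr muln; lia.
have := sum_consecutive r r; have := @sum_consecutive_down r.*2 r.
have -> : r.*2 - r = r by lia.
set S1 := \sum_(_ < _) _; set S2 := \sum_(_ < _) _.
by move=> /(_ ltac:(lia)); rewrite -!mul2n; nia.
Qed.

(** * Lower bounds in terms of the order, size and diameter *)

Section CentralBounds.
Variables (T : finType) (e : rel T) (n m d : nat).
Hypothesis e_graph : cgraph_nmd e n m d.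

Let e_simple : simple_graph e. Proof. by case: e_graph. Qed.
Let e_conn : connected_graph e. Proof. by case: e_graph. Qed.

Lemma cgraph_geodesic : 0 < d -> exists v0 vd (P : nat -> T),
  [/\ dist e v0 vd = d, P 0 = v0, P (dist e v0 vd) = vd &
      forall i, i < dist e v0 vd -> e (P i) (P i.+1)].
Proof.
case: e_graph => _ _ _ _ <- d_gt0.
have [|v0 [vd vd_far]] := @diam_attained T e.
  rewrite lt0n; apply: contraTneq d_gt0 => T0; rewrite -eqn0Ngt /diam big_pred0 //.
  by move=> u; have := fintype0 u T0.
by have [P [P0 Pd Pe]] := geodesicP e_conn v0 vd; exists v0, vd, P.
Qed.

Lemma card_off_spine v0 vd P : dist e v0 vd = d -> P 0 = v0 ->
  P (dist e v0 vd) = vd -> (forall i, i < dist e v0 vd -> e (P i) (P i.+1)) ->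
  d < n /\ #|~: spine e v0 vd P| = n - d - 1.
Proof.
move=> dE P0 Pd Pe; case: e_graph => _ _ <- _ _.
have sP := card_spine e_simple e_conn P0 Pd Pe; rewrite dE in sP.
have := cardsC (spine e v0 vd P); have := max_card (spine e v0 vd P).
by rewrite sP; lia.
Qed.

Lemma card_off_arcs v0 vd P : dist e v0 vd = d -> P 0 = v0 ->
  P (dist e v0 vd) = vd -> (forall i, i < dist e v0 vd -> e (P i) (P i.+1)) ->
  d <= m /\ #|off_arcs e v0 vd P| = (m - d) * 2.
Proof.
move=> dE P0 Pd Pe; case: e_graph => _ _ _ mE _.
have := nedgesE e_simple; rewrite mE (card_arcs_split e_simple e_conn P0 Pd Pe) dE.
by lia.
Qed.

(** [B] counts the ordered off-geodesic pairs with a non-central end. Of the two lower bounds on it,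
    the one from ownership matters when there are few edges, the one from central pairs when there
    are many. *)
Lemma odd_lower h : d.+1 = h * 2 -> exists B : nat,
  [/\ d < n, d <= m,
      path_cost d * 2 + ((m - d) * 2 * h ^ 2 + h * B) <= sigma2 e * 2,
      4 * (n - d - 1) <= (m - d) * 2 + B &
      (m - d) * 2 <= B + ((n - d - 1) ^ 2 + 3 * (n - d - 1))].
Proof.
move=> d_odd; have d_gt0 : 0 < d by lia.
have [v0 [vd [P [dE P0 Pd Pe]]]] := cgraph_geodesic d_gt0.
have [dn off] := card_off_spine dE P0 Pd Pe.
have [dm arcsE] := card_off_arcs dE P0 Pd Pe.
have h1 : h * 2 <= (dist e v0 vd).+1 by rewrite dE; lia.
have h2 : dist e v0 vd <= h * 2 by rewrite dE; lia.
exists (\sum_(p in off_arcs e v0 vd P) bad e h p.1 p.2); split=> //.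
- have := sigma2_lower_bad e_simple e_conn P0 Pd Pe h1 h2.
  by rewrite dE arcsE.
- have := odd_weight e_simple e_conn P0 Pd h1 h2.
  by rewrite dE off arcsE; apply.
- have := odd_good e_simple e_conn P0 Pd Pe h1 h2.
  rewrite dE off => /(_ d_odd).
  rewrite -(leq_add2l (\sum_(p in off_arcs e v0 vd P) bad e h p.1 p.2)).
  by rewrite -off_arcs_bad arcsE.
Qed.

(** [B] counts non-central ends over ordered off-geodesic pairs and [s] the central vertices off the
    geodesic: a larger [s] forces more owned bad edges, a smaller one allows fewer good ones. *)
Lemma even_lower h : 0 < d -> d = h * 2 -> exists B s : nat,
  [/\ d < n, d <= m,
      path_cost d * 2 + ((m - d) * 2 * h ^ 2 + h * B) <= sigma2 e * 2,
      2 * (n - d - 1 + s) <= B &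
      (m - d) * 2 <= B + s * s.+1] /\
  (m - d) * 2 <= (n - d - 1) ^ 2 + 5 * (n - d - 1).
Proof.
move=> d_gt0 d_even.
have [v0 [vd [P [dE P0 Pd Pe]]]] := cgraph_geodesic d_gt0.
have [dn off] := card_off_spine dE P0 Pd Pe.
have [dm arcsE] := card_off_arcs dE P0 Pd Pe.
have h1 : h * 2 <= (dist e v0 vd).+1 by rewrite dE; lia.
have h2 : dist e v0 vd <= h * 2 by rewrite dE; lia.
pose Bd := \sum_(p in off_arcs e v0 vd P) bad e h p.1 p.2.
pose W := \sum_(p in off_arcs e v0 vd P) peripheral_ends e h p.1 p.2.
have BW : Bd <= W by apply: leq_sum => p _; apply: bad_le_peripheral.
have := even_weight e_simple e_conn P0 Pd h1 h2.
rewrite dE off => /(_ d_even) Bge.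
exists W, #|central e h :\: spine e v0 vd P|; split; last first.
  by have := off_arcs_le e_simple e_conn P0 Pd Pe; rewrite off arcsE.
split=> //.
- have := sigma2_lower_peripheral e_simple e_conn P0 Pd Pe h1 h2.
  by rewrite dE arcsE.
- by apply: leq_trans Bge _.
- have := even_good e_simple e_conn P0 Pd Pe h1 h2.
  rewrite dE => /(_ d_even); rewrite -(leq_add2l Bd) -off_arcs_bad arcsE => le1.
  by apply: leq_trans le1 _; rewrite leq_add2r.
Qed.

End CentralBounds.

(** * The exceptional case: diameter four with as many edges as vertices *)

Section UnicyclicDiameterFour.
Variables (T : finType) (e : rel T) (n : nat).
Hypotheses (e_graph : cgraph_nmd e n n 4) (n_ge7 : 7 <= n).

Let e_simple : simple_graph e. Proof. by case: e_graph. Qed.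
Let e_conn : connected_graph e. Proof. by case: e_graph. Qed.

Lemma dist_le2 u v : u != v -> ~~ e u v -> dist e u v <= 2 -> exists2 z, e u z & e z v.
Proof.
move=> uv neuv le2; have [w /andP[uw wv]] := closer_neighbor e_conn uv.
exists w => //; have wv' : w != v by apply: contraNneq neuv => <-.
by rewrite -(dist_eq1 e_conn wv'); apply: leq_trans wv le2.
Qed.

(* As m = n, at most one vertex x off the geodesic is central and no edge off the
   geodesic joins two central vertices.  If the bound failed, no such edge would
   join two non-central vertices either, so every other vertex off the geodesic
   would be adjacent to both x and P 2: too many edges when n >= 7. *)
Lemma unicyclic_diam4_lower : 6 * n + 15 <= sigma2 e.
Proof.
have [v0 [vd [P [dE P0 Pd Pe]]]] := cgraph_geodesic e_graph isT.
have [dn off] := card_off_spine e_graph dE P0 Pd Pe.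
have [dm arcsE] := card_off_arcs e_graph dE P0 Pd Pe.
have h1 : 2 * 2 <= (dist e v0 vd).+1 by rewrite dE.
have h2 : dist e v0 vd <= 2 * 2 by rewrite dE.
set S := spine e v0 vd P in off; set F := off_arcs e v0 vd P in arcsE.
pose C := central e 2; pose s := #|C :\: S|.
have distP i : i <= 4 -> dist e (P i) v0 = i /\ dist e (P i) vd = 4 - i.
  by rewrite -dE; apply: dist_geodesic.
have spineS i : i <= 4 -> P i \in S.
  by move=> i4; apply/spineP; exists i; rewrite ?dE.
have Bge := even_weight e_simple e_conn P0 Pd h1 h2.
have Gle := even_good e_simple e_conn P0 Pd Pe h1 h2.
have FE := off_arcs_bad e v0 vd P 2.
rewrite dE -/S -/C -/F -/s off in Bge Gle FE.
move/(_ erefl) in Bge; move/(_ erefl) in Gle.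
(* Of the [2 * (n - 4)] pairs in [F] at least [2 * (n - 5 + s)] are bad. So [s] is at most 1;
   [s = 1] makes all pairs bad, and [s = 0] excludes good ones by [Gle]. *)
have good0 : #|[set p in F | ~~ bad e 2 p.1 p.2]| = 0 by nia.
have s_le1 : s <= 1 by nia.
have Fbad u v : (u, v) \in F -> ~~ ((u \in C) && (v \in C)).
  move=> uvF; apply/negP => uvC; move/cards0_eq/setP/(_ (u, v)): good0.
  by rewrite in_set0 inE uvF /bad negbK uvC.
have eccge u : 2 <= ecc e u := le_h_ecc e_simple e_conn h1 h2 u.
have eccC u : u \notin C -> 3 <= ecc e u by rewrite inE -ltnNge.
have eccP i : i <= 4 -> maxdist 4 i <= ecc e (P i).
  by have := maxdist_le_ecc e_simple e_conn P0 Pd Pe; rewrite dE; apply.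
rewrite leqNgt; apply/negP => small.
have sE := sigma2E e_simple.
rewrite (arcs_sum_split e_simple e_conn P0 Pd Pe (fun u v => ecc e u * ecc e v)) dE in sE.
have path_ge := path_cost_le e_simple e_conn P0 Pd Pe; rewrite dE in path_ge.
have pc4 : path_cost 4 = 36 by rewrite /path_cost !big_ord_recl big_ord0.
set pathsum := \sum_(i < 4) _ in sE path_ge.
set offsum := \sum_(p in _) _ in sE.
(* Every pair in [F] is bad and costs at least [2 * 3], or [3 * 3] if both ends are non-central. *)
have off_ge : 6 * ((n - 4) * 2) + 3 * #|[set p in F | (p.1 \notin C) && (p.2 \notin C)]| <= offsum.
  rewrite -arcsE -!sum1_card !big_distrr /= [X in _ + X](eq_bigl
     (fun p => (p \in F) && ((p.1 \notin C) && (p.2 \notin C)))) => [|p]; last by rewrite [LHS]inE.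
  rewrite big_mkcondr -big_split /=; apply: leq_sum => -[u v] /Fbad /=.
  have := eccge u; have := eccge v; have := eccC u; have := eccC v.
  case: (u \in C); case: (v \in C) => //=.
  - by move=> /(_ isT) + _ + + _; nia.
  - by move=> _ /(_ isT) + + + _; nia.
  - by move=> /(_ isT) + /(_ isT) + _ _ _; nia.
have one_central u v : (u, v) \in F -> (u \in C) || (v \in C).
  move=> uvF; apply/negPn/negP; rewrite negb_or => /andP[uC vC].
  (* One such edge, counted in both orientations, already lifts [sigma2] from [36 + 6 * (n - 4)] to
     [6 * n + 15]. *)
  suff : 2 <= #|[set p in F | (p.1 \notin C) && (p.2 \notin C)]| by lia.
  have -> : 2 = #|[set (u, v); (v, u)]|.
    rewrite cards2 xpair_eqE negb_and; case: eqVneq => // uv; move: uvF.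
    by rewrite in_off_arcs uv e_simple.2.
  apply/subset_leq_card/subsetP => p /set2P[]->.
    by rewrite inE uvF uC.
  by rewrite inE -(off_arcs_sym e_simple) uvF /= uC vC.
have P2C : P 2 \in C.
  (* The value 78 is [2 * 36 + 6], enough to contradict [small]; the two edges at [P 2] then cost at
     least 9 instead of 6 each. *)
  apply/negPn/negP => /eccC e2; suff : 78 <= pathsum by lia.
  rewrite /pathsum !big_ord_recr big_ord0 /=.
  have e0 : 4 <= ecc e (P 0) := eccP 0 isT; have e1 : 3 <= ecc e (P 1) := eccP 1 isT.
  have e3 : 3 <= ecc e (P 3) := eccP 3 isT; have e4 : 4 <= ecc e (P 4) := eccP 4 isT.
  have := leq_mul e0 e1; have := leq_mul e1 e2; have := leq_mul e2 e3; have := leq_mul e3 e4.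
  by lia.
have CS z : z \in C -> z \in S -> z = P 2.
  move=> /central_dist -/(_ v0 vd)[az bz] /spineP[i]; rewrite dE => i4 zE.
  have [ai bi] := distP i i4; rewrite zE in az bz *; congr (P _); lia.
have offF u v : e u v -> u \notin S -> (u, v) \in F.
  by move=> euv uS; rewrite in_off_arcs euv (negPf uS).
have [s0|s_gt0] := posnP s.
  have onlyP2 z : z \in C -> z = P 2.
    move=> zC; apply: CS => //; apply: contraT => zS.
    by move/cards0_eq/setP/(_ z): s0; rewrite in_set0 in_setD zS zC.
  (* With [P 2] the only central vertex, all off-geodesic edges meet it, which allows [n - 5] of
     them although there are [n - 4]. *)
  have : F \subset [set (P 2, y) | y in ~: S] :|: [set (y, P 2) | y in ~: S].
    apply/subsetP => -[u v] uvF; have := uvF.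
    rewrite in_off_arcs => /andP[_ uvS]; rewrite inE; apply/orP.
    have P2S := spineS 2 isT.
    case/orP: (one_central _ _ uvF) => /onlyP2 zE; rewrite zE P2S ?andbT in uvS *.
      by left; apply/imsetP; exists v; rewrite // inE.
    by right; apply/imsetP; exists u; rewrite // inE.
  move/subset_leq_card; rewrite arcsE => /leq_trans/(_ (leq_card_setU _ _).1).
  have le_img (f : T -> T * T) : #|[set f y | y in ~: S]| <= n - 4 - 1.
    by rewrite -off leq_imset_card.
  have := le_img (fun y => (P 2, y)); have := le_img (fun y => (y, P 2)).
  by clear - n_ge7; move: #|_| #|_| => x y; lia.
have /eqP/cards1P[x xE] : s = 1 by lia.
have [xC xS] : x \in C /\ x \notin S.
  by have := set11 x; rewrite -xE inE => /andP[].
have CE z : z \in C -> z = x \/ z = P 2.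
  move=> zC; case: (boolP (z \in S)) => zS; first by right; apply: CS.
  by left; apply/set1P; rewrite -xE inE zS.
have nxP2 : ~~ e x (P 2).
  by apply/negP => /offF/(_ xS)/Fbad; rewrite xC P2C.
(* Otherwise [u] and the non-central [y] have a common neighbour, central by [one_central]. It would
   be the other one of [x] and [P 2], but these two are not adjacent. *)
have dom u y : u \in C -> y \notin S -> y != x -> e u y.
  move=> uC yS yx; apply: contraT => neuy.
  have yC : y \notin C.
    by apply: contraNN yx => /CE[->//|yE]; rewrite yE (spineS 2) in yS.
  have uy : u != y by apply: contraNneq yC => <-.
  have [|z euz ezy] := dist_le2 uy neuy.
    by apply: leq_trans (dist_le_ecc e u y) _; rewrite inE in uC.
  have zC : z \in C.
    have := offF y z; rewrite e_simple.1 => /(_ ezy yS)/one_central.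
    by rewrite (negPf yC).
  have := nxP2; case: (CE _ uC) (CE _ zC) => [uE|uE] [] zE; move: euz; rewrite uE zE ?e_simple.2 //.
    by move=> ->.
  by rewrite e_simple.1 => ->.
have [e0 a0] := par0P e_conn P0 xS; have [e1 b1] := par1P e_conn Pd xS.
have [ax bx] := central_dist v0 vd xC.
set p0 := par0 e v0 x in e0 a0; set p1 := par1 e vd x in e1 b1.
have dE' u : 4 <= dist e u v0 + dist e u vd.
  by rewrite -dE; apply: le_dist_ends.
have v0S : v0 \in S by rewrite -P0 spineS.
have vdS : vd \in S by rewrite -Pd dE spineS.
(* This puts the parents [p0] and [p1] of [x] on the geodesic, so that the edges owned by [x] are
   not owned again. *)
have nearC u v : dist e u v <= 1 -> v \in S -> v \notin C -> u \notin C -> u \in S.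
  move=> duv vS vC uC; apply: contraT => uS.
  have uv : u != v by apply: contraNneq uS => ->.
  have := offF u v; rewrite -(dist_eq1 e_conn uv) duv => /(_ isT uS)/one_central.
  by rewrite (negPf uC) (negPf vC).
have farC u w : dist e u w >= 3 -> u \notin C.
  by move=> far; rewrite inE -ltnNge (leq_trans far) // dist_le_ecc.
have p0v0 : dist e p0 v0 <= 1 by rewrite -ltnS (leq_trans a0).
have p1vd : dist e p1 vd <= 1 by rewrite -ltnS (leq_trans b1).
have p0vd : 3 <= dist e p0 vd by rewrite -(leq_add2l 1) (leq_trans (dE' p0)) // leq_add2r.
have p1v0 : 3 <= dist e p1 v0 by rewrite -(leq_add2r 1) (leq_trans (dE' p1)) // leq_add2l.
have p0S : p0 \in S.
  apply: (nearC p0 v0) => //; last exact: farC p0vd.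
  by apply: (farC _ vd); rewrite -P0; have [_ ->] := distP 0 isT.
have p1S : p1 \in S.
  apply: (nearC p1 vd) => //; last exact: farC p1v0.
  by apply: (farC _ v0); rewrite -Pd dE; have [-> _] := distP 4 isT.
have p01 : p0 != p1.
  by apply: contraTneq p0vd => ->; rewrite -ltnNge ltnS (leq_trans p1vd).
(* All [n - 5] vertices off the geodesic own two edges each, and [2 * (n - 5)] exceeds [n - 4] once
   [n] is at least 7. *)
pose O u v := if u == x then (v == p0) || (v == p1)
              else (u \notin S) && ((v == x) || (v == P 2)).
have x2 : x != P 2 by apply: contraNneq xS => ->; apply: spineS.
have OF u v : O u v -> (u, v) \in F.
  rewrite /O; case: eqVneq => [-> /orP[] /eqP->|ux /andP[uS] /orP[] /eqP->]; try exact: offF.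
    by apply: offF => //; rewrite e_simple.1; apply: dom.
  by apply: offF => //; rewrite e_simple.1; apply: dom.
have O_anti u v : O u v -> ~~ O v u.
  rewrite /O; case: eqVneq => [-> uv|ux /andP[uS uv]].
    have vS : v \in S by case/orP: uv => /eqP->.
    have -> : (v == x) = false by apply/negbTE; apply: contraNneq xS => <-.
    by rewrite vS.
  case/orP: uv => /eqP->.
    rewrite eqxx negb_or; apply/andP.
    by split; apply: contraNneq uS => ->.
  by rewrite eq_sym (negPf x2) (spineS 2).
have F_sym : sym_pairs F by apply: off_arcs_sym.
have := sum_owned (w := fun _ _ => 1) F_sym (fun _ _ => erefl) OF O_anti.
rewrite sum1_card arcsE.
suff : 2 * (n - 5) <= \sum_u \sum_(v | O u v) 1.
  by clear - n_ge7; move: (\sum_u _) => y; lia.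
have -> : n - 5 = #|~: S| by rewrite off -subnDA.
rewrite mulnC -sum_nat_const big_mkcond /=; apply: leq_sum => u _.
rewrite inE; case: ifP => // uS; rewrite sum1dep_card /O uS /=.
case: eqVneq => [ux|ux].
  have -> : 2 = #|[set p0; p1]| by rewrite cards2 p01.
  by apply/subset_leq_card/subsetP => v; rewrite !inE.
apply: (@leq_trans #|[set x; P 2]|); first by rewrite cards2 x2.
by apply/subset_leq_card/subsetP => v; rewrite !inE.
Qed.

End UnicyclicDiameterFour.

(** * Graphs with a level function *)

Section Intermediate.
Variables (T : finType) (e1 e2 : rel T).
Hypotheses (e1_simple : simple_graph e1) (e2_simple : simple_graph e2).
Hypothesis e12 : subrel e1 e2.

Lemma nedges_lt u v : e2 u v -> ~~ e1 u v -> nedges e1 < nedges e2.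
Proof.
move=> e2uv e1uv.
have : arcs e1 \proper arcs e2.
  apply/properP; split; first by apply/subsetP => p; rewrite !inE; apply: e12.
  by exists (u, v); rewrite inE.
by move/proper_card; rewrite -!nedgesE // ltn_mul2r.
Qed.

Lemma intermediate_graph m : nedges e1 <= m <= nedges e2 ->
  exists e, [/\ simple_graph e, subrel e1 e, subrel e e2 & nedges e = m].
Proof.
case/andP=> le1m; rewrite -(subnKC le1m); elim: (m - _) => [|k IHk] le2.
  by exists e1; rewrite addn0; split=> // u v.
case: IHk => [|e [e_simple e1e ee2 eE]]; first by lia.
have [[u v] uv2 uv] : exists2 p, p \in arcs e2 & p \notin arcs e.
  apply/subsetPn; apply/negP => /subset_leq_card.
  by rewrite -!nedgesE // leq_mul2r; lia.
rewrite !in_arcs in uv2 uv.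
have uNv : u != v by apply: contraTneq uv2 => ->; rewrite e2_simple.2.
pose e' x y := [|| e x y, (x == u) && (y == v) | (x == v) && (y == u)].
have e'_simple : simple_graph e'.
  split=> [x y|x]; rewrite /e'.
    by rewrite e_simple.1 [(y == u) && _]andbC [(y == v) && _]andbC [X in _ || X]orbC.
  rewrite e_simple.2 /=; apply/negP => /orP[] /andP[/eqP xu /eqP xv];
  by rewrite -xu -xv eqxx in uNv.
exists e'; split=> //.
- by move=> x y /e1e exy; rewrite /e' exy.
- move=> x y /or3P[/ee2//|/andP[/eqP-> /eqP->]//|/andP[/eqP-> /eqP->]].
  by rewrite e2_simple.1.
apply/eqP; rewrite -(eqn_pmul2r (isT : 0 < 2)) nedgesE //.
have -> : arcs e' = (u, v) |: ((v, u) |: arcs e).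
  by apply/setP => -[x y]; rewrite !inE /= !xpair_eqE /e' /=; case: (e x y); rewrite ?orbT ?orbF.
rewrite !cardsU1 !inE /= xpair_eqE (negPf uNv) /= uv e_simple.1 uv -nedgesE // eE.
by apply/eqP; lia.
Qed.

(** With a single cost [K] for all optional edges, the total depends only on how many of them are
    present. *)
Lemma arcs_sum_intermediate (e : rel T) (w : T -> T -> nat) K :
  simple_graph e -> subrel e1 e -> subrel e e2 ->
  (forall u v, e2 u v -> ~~ e1 u v -> w u v = K) ->
  \sum_(p in arcs e) w p.1 p.2 =
  \sum_(p in arcs e1) w p.1 p.2 + K * (nedges e - nedges e1) * 2.
Proof.
move=> e_simple e1e ee2 wK.
have sub : arcs e1 \subset arcs e by apply/subsetP => p; rewrite !inE; apply: e1e.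
rewrite (big_setID (arcs e1)) /= (setIidPr sub); congr addn.
rewrite (eq_bigr (fun _ => K)) => [|[u v]]; last first.
  by rewrite inE !in_arcs => /andP[e1uv /ee2 e2uv]; apply: wK.
rewrite sum_nat_const cardsD (setIidPr sub) -!nedgesE //.
by rewrite -mulnBl mulnC mulnA.
Qed.

End Intermediate.

Section Leveled.
Variables (T : finType) (e : rel T) (d : nat) (lev : T -> nat).
Hypothesis e_simple : simple_graph e.
Hypothesis lev_le : forall u, lev u <= d.
Hypothesis lev_lip : forall u v, e u v -> lev v <= (lev u).+1.
Hypothesis lev_min : exists u, lev u = 0.
Hypothesis lev_max : exists u, lev u = d.
Hypothesis reach : forall u v, exists2 k, k <= maxdist d (lev u) & walkb e u v k.

Lemma leveled_connected : connected_graph e.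
Proof.
move=> u v; have [k _ /walkbP[p [ep lp _]]] := reach u v.
by apply/connectP; exists p.
Qed.

(** [reach] gives the upper bound; the lower bound comes from the distances to a vertex of level 0
    and to one of level [d], since levels change by at most one along an edge. *)
Lemma leveled_ecc u : ecc e u = maxdist d (lev u).
Proof.
apply/eqP; rewrite eqn_leq; apply/andP; split.
  apply/bigmax_leqP => v _; have [k le_k /dist_le uv] := reach u v.
  exact: leq_trans uv le_k.
have lip x y : lev y <= lev x + dist e x y.
  exact: walkb_lipschitz lev_lip (walkb_dist (leveled_connected x y)).
have [z0 z0E] := lev_min; have [zd zdE] := lev_max.
rewrite geq_max; apply/andP; split; last first.
  by apply: leq_trans (dist_le_ecc e u zd); have := lip u zd; rewrite zdE; lia.
apply: leq_trans (dist_le_ecc e u z0); have := lip z0 u.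
by rewrite z0E (dist_sym e_simple.1 leveled_connected).
Qed.

Lemma leveled_diam : diam e = d.
Proof.
apply/eqP; rewrite eqn_leq; apply/andP; split.
  apply/bigmax_leqP => u _; rewrite leveled_ecc geq_max lev_le.
  by rewrite leq_subr.
have [z0 z0E] := lev_min; apply: leq_trans (ecc_le_diam e z0).
by rewrite leveled_ecc z0E /maxdist max0n subn0.
Qed.

End Leveled.

Section Spined.
Variables (d t : nat).
Notation V := ('I_d.+1 + 'I_t)%type.

Definition spined (s : 'I_t -> seq nat) (B : rel 'I_t) : rel V := fun u v =>
  match u, v with
  | inl i, inl j => (j == i.+1 :> nat) || (i == j.+1 :> nat)
  | inl i, inr x => (i : nat) \in s x
  | inr x, inl i => (i : nat) \in s x
  | inr x, inr y => B x y
  end.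

Definition level (l : 'I_t -> nat) (u : V) : nat :=
  match u with inl i => i | inr x => l x end.

Lemma spined_simple s (B : rel 'I_t) :
  symmetric B -> irreflexive B -> simple_graph (spined s B).
Proof.
move=> B_sym B_irr; split=> [[i|x] [j|y]|[i|x]] //=; first by rewrite orbC.
by rewrite (ltn_eqF (ltnSn i)).
Qed.

Lemma sum_window (s : seq nat) (F : nat -> nat) :
  uniq s -> {in s, forall i, i <= d} ->
  \sum_(i < d.+1 | (i : nat) \in s) F i = \sum_(i <- s) F i.
Proof.
move=> s_uniq s_le.
rewrite -(big_mkord (fun i => i \in s) F) -big_filter; apply: perm_big.
apply: uniq_perm; rewrite ?filter_uniq ?iota_uniq // => i.
rewrite mem_filter mem_index_iota; case is_s: (i \in s) => //=.
by rewrite ltnS s_le.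
Qed.

Lemma spined_sum s B l (g : nat -> nat -> nat) :
  (forall i j, g i j = g j i) -> (forall x, uniq (s x)) ->
  (forall x, {in s x, forall i, i <= d}) ->
  \sum_(p in arcs (spined s B)) g (level l p.1) (level l p.2) =
  2 * \sum_(i < d) g i i.+1 + 2 * \sum_x \sum_(i <- s x) g (l x) i +
  \sum_x \sum_(y | B x y) g (l x) (l y).
Proof.
move=> g_sym s_uniq s_le.
rewrite (eq_bigl (fun p => spined s B p.1 p.2)) => [|p]; last by rewrite inE.
rewrite -(pair_big_dep xpredT (spined s B) (fun u v => g (level l u) (level l v))) /=.
rewrite big_sumType /=.
under eq_bigr => i _ do rewrite big_sumType /=.
under [X in _ + X]eq_bigr => x _ do rewrite big_sumType /= sum_window //.
rewrite !big_split /= path_arcs_sum (exchange_big_dep xpredT) //=.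
have -> : \sum_j \sum_(i < d.+1 | (i : nat) \in s j) g i (l j) =
          \sum_x \sum_(i <- s x) g (l x) i.
  apply: eq_bigr => x _; rewrite (sum_window (fun i => g i (l x))) //.
  by apply: eq_bigr => i _; apply: g_sym.
have -> : \sum_(i < d) (g i i.+1 + g i.+1 i) = 2 * \sum_(i < d) g i i.+1.
  by rewrite big_distrr; apply: eq_bigr => i _; rewrite [g i.+1 i]g_sym /= mul2n addnn.
by set S := \sum_x \sum_(i <- s x) _; rewrite [2 * S]mul2n -addnn !addnA.
Qed.

(** The short walks use only edges of the smaller graph and the level condition is checked on the
    larger one, so every graph in between has the prescribed eccentricities. The sum
    [w - i + (i - w)] is the absolute difference: a walk enters the path at [w], runs along it and
    possibly leaves it again. *)
Lemma spined_realize (s1 s2 : 'I_t -> seq nat) (B1 B2 : rel 'I_t) l m K :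
  symmetric B1 -> irreflexive B1 -> symmetric B2 -> irreflexive B2 ->
  (forall x, {subset s1 x <= s2 x}) -> subrel B1 B2 -> (forall x, uniq (s1 x)) ->
  (forall x i, i \in s2 x -> [&& i <= d, i <= (l x).+1 & l x <= i.+1]) ->
  (forall x, l x <= d) -> (forall x y, B2 x y -> l y <= (l x).+1) ->
  (forall x i, i <= d -> exists2 w, w \in s1 x &
     (w - i + (i - w)).+1 <= minn (maxdist d (l x)) (maxdist d i)) ->
  (forall x y, x != y -> exists w w', [/\ w \in s1 x, w' \in s1 y &
     (w - w' + (w' - w)).+2 <= maxdist d (l x)]) ->
  (forall x i, i \in s2 x -> i \notin s1 x -> maxdist d (l x) * maxdist d i = K) ->
  (forall x y, B2 x y -> ~~ B1 x y -> maxdist d (l x) * maxdist d (l y) = K) ->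
  nedges (spined s1 B1) <= m <= nedges (spined s2 B2) ->
  exists (T : finType) (e : rel T), cgraph_nmd e (d.+1 + t) m d /\
    sigma2 e * 2 = path_cost d * 2 +
      2 * \sum_x \sum_(i <- s1 x) maxdist d (l x) * maxdist d i +
      \sum_x \sum_(y | B1 x y) maxdist d (l x) * maxdist d (l y) +
      K * (m - nedges (spined s1 B1)) * 2.
Proof.
move=> B1_sym B1_irr B2_sym B2_irr s12 B12 s1_uniq s2_near l_le B2_lip.
move=> to_spine to_off Ks KB m_between.
have e1_simple := spined_simple s1 B1_sym B1_irr.
have e2_simple := spined_simple s2 B2_sym B2_irr.
have e12 : subrel (spined s1 B1) (spined s2 B2).
  move=> [i|x] [j|y] //=; try exact: s12; exact: B12.
have [e [e_simple e1e ee2 eE]] := intermediate_graph e1_simple e2_simple e12 m_between.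
have lip u v : e u v -> level l v <= (level l u).+1.
  move/ee2; case: u v => [i|x] [j|y] /=; first by lia.
  - by case/s2_near/and3P.
  - by case/s2_near/and3P.
  - exact: B2_lip.
have spine_walk i j k : i <= j <= d -> k = j - i ->
    walkb e (inl (inord i)) (inl (inord j)) k.
  move=> ijd kE; have -> : j = i + k by lia.
  have {ijd kE} : i + k <= d by lia.
  elim: k => [|k IHk] id; first by rewrite addn0 walkb0.
  rewrite addnS -[k.+1]addn1; apply: walkb_cat (IHk _) _; first by lia.
  by apply/walkb1/e1e; rewrite /= !inordK ?eqxx //; lia.
have spine_walk2 i j : i <= d -> j <= d ->
    walkb e (inl (inord i)) (inl (inord j)) (i - j + (j - i)).
  move=> id jd; case: (leqP i j) => ij; first by apply: spine_walk; lia.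
  by apply: (walkb_sym e_simple.1); apply: spine_walk; lia.
have s1_le x i : i \in s1 x -> i <= d by move/s12/s2_near/and3P => [].
have hook x i : i \in s1 x -> walkb e (inr x) (inl (inord i)) 1.
  by move=> ix; apply/walkb1/e1e; rewrite /= inordK // ltnS (s1_le x).
have hook' x i : i \in s1 x -> walkb e (inl (inord i)) (inr x) 1.
  by move=> ix; apply: (walkb_sym e_simple.1); apply: hook.
have reach u v : exists2 k, k <= maxdist d (level l u) & walkb e u v k.
  case: u v => [i|x] [j|y] /=.
  - exists (i - j + (j - i)); last first.
      by have := @spine_walk2 i j; rewrite !inord_val; apply; rewrite -ltnS.
    by have := ltn_ord j; rewrite /maxdist; lia.
  - have id : i <= d by rewrite -ltnS.
    have [w wx le_w] := to_spine y i id; exists (i - w + (w - i) + 1).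
      by move: le_w; rewrite leq_min; lia.
    apply: walkb_cat (hook' _ _ wx); rewrite -{1}[i]inord_val; apply: spine_walk2 => //.
    exact: s1_le wx.
  - have jd : j <= d by rewrite -ltnS.
    have [w wx le_w] := to_spine x j jd; exists (1 + (w - j + (j - w))).
      by move: le_w; rewrite leq_min; lia.
    apply: walkb_cat (hook _ _ wx) _; rewrite -{1}[j]inord_val; apply: spine_walk2 => //.
    exact: s1_le wx.
  - case: (eqVneq x y) => [->|xy]; first by exists 0; rewrite ?walkb0.
    have [w [w' [wx wy le_w]]] := to_off x y xy.
    exists (1 + (w - w' + (w' - w)) + 1); first by lia.
    apply: walkb_cat (hook' _ _ wy); apply: walkb_cat (hook _ _ wx) _.
    by apply: spine_walk2; [apply: s1_le wx | apply: s1_le wy].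
have lev_le u : level l u <= d by case: u => [i|x] //=; rewrite -ltnS.
have lev_min : exists u, level l u = 0 by exists (inl ord0).
have lev_max : exists u, level l u = d by exists (inl ord_max).
have e_ecc := leveled_ecc e_simple lip lev_min lev_max reach.
exists V, e; split.
  split=> //; first exact: leveled_connected reach.
    by rewrite card_sum !card_ord.
  exact: leveled_diam e_simple lev_le lip lev_min lev_max reach.
rewrite sigma2E //.
rewrite (eq_bigr (fun p => maxdist d (level l p.1) * maxdist d (level l p.2))); last first.
  by move=> p _; rewrite !e_ecc.
rewrite (@arcs_sum_intermediate _ _ (spined s2 B2) e1_simple e
   (fun u v => maxdist d (level l u) * maxdist d (level l v)) K) //; last first.
  case=> [i|x] [j|y] /=; first by move=> ->.
  - by move=> /Ks H /H <-; rewrite mulnC.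
  - exact: Ks.
  - exact: KB.
rewrite eE (spined_sum _ _ (g := fun i j => maxdist d i * maxdist d j)) //.
- by rewrite /path_cost [2 * \sum_(i < d) _]mulnC.
- by move=> i j; rewrite mulnC.
Qed.

Lemma spined_nedges s B : symmetric B -> irreflexive B -> (forall x, uniq (s x)) ->
  (forall x, {in s x, forall i, i <= d}) ->
  nedges (spined s B) * 2 =
  2 * d + 2 * \sum_x size (s x) + \sum_x \sum_(y | B x y) 1.
Proof.
move=> B_sym B_irr s_uniq s_le; rewrite nedgesE; last exact: spined_simple.
rewrite -sum1_card (spined_sum B (fun _ => 0) (g := fun _ _ => 1)) //.
rewrite big_const_ord iter_addn_0 mul1n.
by under eq_bigr => x _ do rewrite sum1_size.
Qed.

Definition clique k : rel 'I_t := fun x y => [&& x < k, y < k & x != y].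

Lemma clique_sym k : symmetric (clique k).
Proof. by move=> x y; rewrite /clique eq_sym andbCA. Qed.

Lemma clique_irr k : irreflexive (clique k).
Proof. by move=> x; rewrite /clique eqxx !andbF. Qed.

Lemma sum_first k (a b : nat) : k <= t ->
  \sum_(x < t) (if x < k then a else b) = k * a + (t - k) * b.
Proof.
move=> kt; rewrite -(big_mkord xpredT (fun x => if x < k then a else b)).
rewrite (big_cat_nat _ (n := k)) //= big_nat [X in _ + X]big_nat.
rewrite (eq_bigr (fun _ => a)) => [|i /andP[_ ->]//].
rewrite [X in _ + X](eq_bigr (fun _ => b)) => [|i /andP[ki _]]; last by rewrite ltnNge ki.
by rewrite -!big_nat !sum_nat_const_nat subn0.
Qed.

Lemma sum_clique k c : k <= t ->
  \sum_x \sum_(y | clique k x y) c = k * (k - 1) * c.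
Proof.
move=> kt; rewrite -[c]muln1 -[RHS]/(k * (k - 1) * (c * 1)) muln1.
have -> : k * (k - 1) = #|[set p : 'I_t * 'I_t | clique k p.1 p.2]|.
  have kE : #|[set x : 'I_t | x < k]| = k.
    rewrite -sum1dep_card big_mkcond /= sum_first //; lia.
  rewrite -{1 2}kE -card_offdiag; apply: eq_card => p.
  by rewrite !inE /clique.
by rewrite pair_big_dep /= sum_nat_cond_const cardsE.
Qed.

End Spined.

(** * The extremal families *)

Section Extremal.
Variables (t : nat).

Definition two A k (a b : A) : 'I_t -> A := fun x => if x < k then a else b.

Lemma sum_two k (sA sB : seq nat) lA lB (g : nat -> nat -> nat) : k <= t ->
  \sum_x \sum_(i <- two k sA sB x) g (two k lA lB x) i =
  k * (\sum_(i <- sA) g lA i) + (t - k) * (\sum_(i <- sB) g lB i).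
Proof.
move=> kt; rewrite -sum_first //; apply: eq_bigr => x _.
by rewrite /two; case: ifP.
Qed.

Lemma nedges_two d k (sA sB : seq nat) j : k <= t -> j <= t ->
  uniq sA -> uniq sB -> {in sA, forall i, i <= d} -> {in sB, forall i, i <= d} ->
  nedges (spined (d := d) (two k sA sB) (clique j)) * 2 =
  2 * d + 2 * (k * size sA + (t - k) * size sB) + j * (j - 1).
Proof.
move=> kt jt uA uB leA leB; rewrite spined_nedges ?sum_clique ?muln1 //.
- congr (_ + 2 * _ + _); rewrite -sum_first //.
  by apply: eq_bigr => x _; rewrite /two; case: ifP.
- exact: clique_sym.
- exact: clique_irr.
- by move=> x; rewrite /two; case: ifP.
- by move=> x; rewrite /two; case: ifP.
Qed.

(* Each of the extremal graphs is a path 0, ..., d with t further vertices.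
   The first k of these see the part sA of the path and have level lA, the
   others see sB and have level lB; the optional edges, which lead from
   (sA, sB, j) to (sA', sB', j') and all have the same cost K, realize every
   admissible number of edges. *)
Lemma two_realize d k (sA sB sA' sB' : seq nat) lA lB j j' m q K :
  k <= t -> j <= j' -> j' <= t ->
  uniq sA -> uniq sB -> uniq sA' -> uniq sB' ->
  {subset sA <= sA'} -> {subset sB <= sB'} ->
  {in sA', forall i, [&& i <= d, i <= lA.+1 & lA <= i.+1]} ->
  {in sB', forall i, [&& i <= d, i <= lB.+1 & lB <= i.+1]} ->
  lA <= d -> lB <= d -> (lA <= lB.+1) && (lB <= lA.+1) ->
  (0 < k -> forall i, i <= d -> exists2 w, w \in sA &
     (w - i + (i - w)).+1 <= minn (maxdist d lA) (maxdist d i)) ->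
  (k < t -> forall i, i <= d -> exists2 w, w \in sB &
     (w - i + (i - w)).+1 <= minn (maxdist d lB) (maxdist d i)) ->
  (0 < k -> exists2 w, w \in sA & 2 <= maxdist d lA) ->
  (k < t -> exists2 w, w \in sB & 2 <= maxdist d lB) ->
  (0 < k < t -> exists w w', [/\ w \in sA, w' \in sB &
     (w - w' + (w' - w)).+2 <= minn (maxdist d lA) (maxdist d lB)]) ->
  (0 < k -> {in sA', forall i, i \notin sA -> maxdist d lA * maxdist d i = K}) ->
  (k < t -> {in sB', forall i, i \notin sB -> maxdist d lB * maxdist d i = K}) ->
  (j < j' -> forall x y : 'I_t, clique j' x y ->
     maxdist d (two k lA lB x) * maxdist d (two k lA lB y) = K) ->
  2 * d + 2 * (k * size sA + (t - k) * size sB) + j * (j - 1) + q * 2 = m * 2 ->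
  m * 2 <= 2 * d + 2 * (k * size sA' + (t - k) * size sB') + j' * (j' - 1) ->
  exists (T : finType) (e : rel T), cgraph_nmd e (d.+1 + t) m d /\
    sigma2 e * 2 = path_cost d * 2 +
      2 * (k * (\sum_(i <- sA) maxdist d lA * maxdist d i) +
           (t - k) * (\sum_(i <- sB) maxdist d lB * maxdist d i)) +
      \sum_(x < t) \sum_(y < t | clique j x y)
         maxdist d (two k lA lB x) * maxdist d (two k lA lB y) +
      K * (q * 2).
Proof.
move=> kt jj' j't uA uB uA' uB' subA subB nearA nearB leA leB lipAB.
move=> spA spB offA offB offAB KA KB KC mE m_le.
have leA' : {in sA', forall i, i <= d} by move=> i /nearA/and3P[].
have leB' : {in sB', forall i, i <= d} by move=> i /nearB/and3P[].
have n1 := @nedges_two d k sA sB j kt (leq_trans jj' j't) uA uB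
  (fun i iA => leA' i (subA i iA)) (fun i iB => leB' i (subB i iB)).
have n2 := @nedges_two d k sA' sB' j' kt j't uA' uB' leA' leB'.
have k_gt0 (x : 'I_t) : x < k -> 0 < k by case: (k).
have k_ltt (x : 'I_t) : k <= x -> k < t by move/leq_ltn_trans; apply.
have [||||||||||||||| T [e [e_graph eE]]] := @spined_realize d t (two k sA sB) (two k sA' sB')
  (clique j) (clique j') (two k lA lB) m K.
- exact: clique_sym.
- exact: clique_irr.
- exact: clique_sym.
- exact: clique_irr.
- by move=> x; rewrite /two; case: ifP.
- by move=> x y /and3P[xj yj xy]; rewrite /clique xy !(leq_trans _ jj').
- by move=> x; rewrite /two; case: ifP.
- by move=> x i; rewrite /two; case: ifP => _; [apply: nearA | apply: nearB].
- by move=> x; rewrite /two; case: ifP.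
- by move=> x y _; rewrite /two; case/andP: lipAB => *; do 2![case: ifP].
- by move=> x i id; rewrite /two; case: ltnP => [/k_gt0 /spA|/k_ltt /spB]; apply.
- move=> x y _; rewrite /two; case: (ltnP x k) => [xk|kx]; case: (ltnP y k) => [yk|ky].
  + have [w wA le2] := offA (k_gt0 _ xk).
    by exists w, w; split=> //; rewrite subnn.
  + have [|w [w' [wA wB]]] := offAB; first by rewrite (k_gt0 x) ?(k_ltt y).
    by rewrite leq_min => /andP[? _]; exists w, w'.
  + have [|w [w' [wA wB]]] := offAB; first by rewrite (k_gt0 y) ?(k_ltt x).
    by rewrite leq_min addnC => /andP[_ ?]; exists w', w.
  + have [w wB le2] := offB (k_ltt _ kx).
    by exists w, w; split=> //; rewrite subnn.
- by move=> x i; rewrite /two; case: ltnP => [/k_gt0 /KA|/k_ltt /KB]; apply.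
- move=> x y xy' nxy; apply: KC => //; rewrite ltn_neqAle jj' andbT.
  by apply: contraNneq nxy => ->.
- rewrite -(leq_pmul2r (isT : 0 < 2)) -[X in _ && X](leq_pmul2r (isT : 0 < 2)) n1 n2.
  by rewrite m_le -mE leq_addr.
exists T, e; split=> //; rewrite eE (sum_two _ _ _ _ (fun i j => maxdist d i * maxdist d j)) //.
congr (_ + _).
by rewrite -mulnA mulnBl n1 -mE addKn.
Qed.



Lemma sum_clique0 (F : 'I_t -> 'I_t -> nat) : \sum_x \sum_(y | clique 0 x y) F x y = 0.
Proof. by rewrite big1 // => x _; rewrite big_pred0. Qed.

Lemma maxdist_odd r : 0 < r ->
  [/\ maxdist (r * 2).+1 r = r.+1, maxdist (r * 2).+1 r.+1 = r.+1 &
      maxdist (r * 2).+1 r.-1 = r.+2].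
Proof. by move=> r0; rewrite /maxdist; split; lia. Qed.

Lemma maxdist_even r : 0 < r ->
  [/\ maxdist (r * 2) r = r, maxdist (r * 2) r.+1 = r.+1 &
      maxdist (r * 2) r.-1 = r.+1].
Proof. by move=> r0; rewrite /maxdist; split; lia. Qed.

(** The first [k] vertices are pendant at [r], with eccentricity [r + 2]; the others see both middle
    vertices. *)
Lemma odd_low_graph r k : 0 < r -> k <= t ->
  exists (T : finType) (e : rel T),
    cgraph_nmd e ((r * 2).+2 + t) ((r * 2).+1 + t + (t - k)) (r * 2).+1 /\
    sigma2 e = path_cost (r * 2).+1 + (t + (t - k)) * r.+1 ^ 2 + k * r.+1.
Proof.
move=> r0 kt; have [Mr Mr1 Mp] := maxdist_odd r0.
have [|||||||||||||||||||||||T [e [e_graph eE]]] := @two_realize (r * 2).+1 k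
  [:: r] [:: r; r.+1] [:: r] [:: r; r.+1] r.-1 r 0 0 ((r * 2).+1 + t + (t - k)) 0 0 kt;
  rewrite ?Mr ?Mr1 ?Mp //=;
  try by [rewrite !inE; lia | move=> i; rewrite !inE; lia | lia | move=> _ i ->].
- by move=> _ i id; exists r; rewrite ?inE // /maxdist; lia.
- move=> _ i id; exists (if i <= r then r else r.+1); first by rewrite !inE; case: ifP; lia.
  by case: ifP; rewrite /maxdist; lia.
- by move=> _; exists r; rewrite ?inE.
- by move=> _; exists r; rewrite ?inE ?eqxx.
- by move=> _; exists r, r; rewrite !inE !eqxx; split=> //; lia.
exists T, e; split=> //; apply/eqP; rewrite -(eqn_pmul2r (isT : 0 < 2)) eE.
by rewrite sum_clique0 !big_cons !big_nil Mr Mr1 Mp; apply/eqP; nia.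
Qed.

(** All further vertices see both middle vertices and have eccentricity [r + 1]; the optional edges
    join them to each other. *)
Lemma odd_mid_graph r q : 0 < r -> q * 2 <= t * (t - 1) ->
  exists (T : finType) (e : rel T),
    cgraph_nmd e ((r * 2).+2 + t) ((r * 2).+1 + t * 2 + q) (r * 2).+1 /\
    sigma2 e = path_cost (r * 2).+1 + (t * 2 + q) * r.+1 ^ 2.
Proof.
move=> r0 qt; have [Mr Mr1 Mp] := maxdist_odd r0.
have [|||||||||||||||||||||||T [e [e_graph eE]]] := @two_realize (r * 2).+1 0
  [:: r; r.+1] [:: r; r.+1] [:: r; r.+1] [:: r; r.+1] r r 0 t
  ((r * 2).+1 + t * 2 + q) q (r.+1 ^ 2) (leq0n t);
  rewrite ?Mr ?Mr1 ?Mp //=;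
  try by [rewrite !inE; lia | move=> i; rewrite !inE; lia | lia | move=> _ i ->].
- move=> _ i id; exists (if i <= r then r else r.+1); first by rewrite !inE; case: ifP; lia.
  by case: ifP; rewrite /maxdist; lia.
- by move=> _; exists r; rewrite ?inE ?eqxx.
- by move=> _ x y _; rewrite /two /= Mr mulnn.
exists T, e; split=> //; apply/eqP; rewrite -(eqn_pmul2r (isT : 0 < 2)) eE.
by rewrite sum_clique0 !big_cons !big_nil Mr Mr1; apply/eqP; nia.
Qed.

(** Now the further vertices form a clique, and the optional edges lead to [r - 1], of eccentricity
    [r + 2]. *)
Lemma odd_high_graph r q : 0 < r -> q <= t ->
  exists (T : finType) (e : rel T),
    cgraph_nmd e ((r * 2).+2 + t) ((r * 2).+1 + t * 2 + 'C(t, 2) + q) (r * 2).+1 /\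
    sigma2 e = path_cost (r * 2).+1 + (t * 2 + 'C(t, 2) + q) * r.+1 ^ 2 + q * r.+1.
Proof.
move=> r0 qt; have [Mr Mr1 Mp] := maxdist_odd r0; have bin2t := bin2_double t.
have [|||||||||||||||||||||||T [e [e_graph eE]]] := @two_realize (r * 2).+1 0
  [:: r; r.+1] [:: r; r.+1] [:: r; r.+1] [:: r.-1; r; r.+1] r r t t
  ((r * 2).+1 + t * 2 + 'C(t, 2) + q) q (r.+1 * r.+2) (leq0n t);
  rewrite ?Mr ?Mr1 ?Mp //=;
  try by [rewrite !inE; lia | move=> i; rewrite !inE; lia | lia | move=> _ i ->].
- move=> _ i id; exists (if i <= r then r else r.+1); first by rewrite !inE; case: ifP; lia.
  by case: ifP; rewrite /maxdist; lia.
- by move=> _; exists r; rewrite ?inE ?eqxx.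
- by move=> _ i; rewrite !inE => /orP[/eqP->|->//]; rewrite Mp.
exists T, e; split=> //; apply/eqP; rewrite -(eqn_pmul2r (isT : 0 < 2)) eE.
have -> : \sum_(x < t) \sum_(y < t | clique t x y) maxdist (r * 2).+1 (two 0 r r x) *
    maxdist (r * 2).+1 (two 0 r r y) = t * (t - 1) * (r.+1 * r.+1).
  rewrite -(@sum_clique t t) //; apply: eq_bigr => x _; apply: eq_bigr => y _.
  by rewrite /two /= Mr.
by rewrite !big_cons !big_nil Mr Mr1; apply/eqP; nia.
Qed.

(** The first [k] vertices are central and see [r - 1] and [r + 1], the others are pendant at [r];
    edges among the former or to [r] are optional. Without them a central and a pendant vertex can
    be at distance 3, which for [r = 2] is too far: hence the disjunction. *)
Lemma even_loose_graph r k q : 1 < r -> k <= t -> (2 < r) || (k == t) ->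
  q * 2 <= k * k.+1 ->
  exists (T : finType) (e : rel T),
    cgraph_nmd e ((r * 2).+1 + t) (r * 2 + t + k + q) (r * 2) /\
    sigma2 e = path_cost (r * 2) + (t + k + q) * r ^ 2 + (t + k) * r.
Proof.
move=> r1 kt rk qk; have [Mr Mr1 Mp] := maxdist_even (ltnW r1).
have [|||||||||||||||||||||||T [e [e_graph eE]]] := @two_realize (r * 2) k
  [:: r.-1; r.+1] [:: r] [:: r.-1; r; r.+1] [:: r] r r.-1 0 k
  (r * 2 + t + k + q) q (r ^ 2) kt;
  rewrite ?Mr ?Mr1 ?Mp //=;
  try by [rewrite !inE; lia | move=> i; rewrite !inE; lia | lia | move=> _ i ->].
- move=> _ i id; exists (if i <= r then r.-1 else r.+1); first by rewrite !inE; case: ifP; lia.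
  by case: ifP; rewrite /maxdist; lia.
- by move=> _ i id; exists r; rewrite ?inE // /maxdist; lia.
- by move=> _; exists r.-1; rewrite ?inE ?eqxx.
- by move=> _; exists r; rewrite ?inE ?eqxx; lia.
- by move=> kt0; exists r.-1, r; rewrite !inE !eqxx; split=> //; lia.
- move=> _ i; rewrite !inE => /or3P[] /eqP->; rewrite ?eqxx ?orbT //.
  by rewrite Mr mulnn.
- by move=> _ x y /and3P[xk yk _]; rewrite /two xk yk Mr mulnn.
- by nia.
exists T, e; split=> //; apply/eqP; rewrite -(eqn_pmul2r (isT : 0 < 2)) eE.
by rewrite sum_clique0 !big_cons !big_nil Mr Mr1 Mp; apply/eqP; nia.
Qed.

(** The edges from the central vertices to [r] are now compulsory, which keeps them within distance
    2 of the pendant ones and admits [r = 2]. *)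
Lemma even_tight_graph r k q : 1 < r -> k <= t -> q * 2 <= k * (k - 1) ->
  exists (T : finType) (e : rel T),
    cgraph_nmd e ((r * 2).+1 + t) (r * 2 + t + k * 2 + q) (r * 2) /\
    sigma2 e = path_cost (r * 2) + (t + k * 2 + q) * r ^ 2 + (t + k) * r.
Proof.
move=> r1 kt qk; have [Mr Mr1 Mp] := maxdist_even (ltnW r1).
have [|||||||||||||||||||||||T [e [e_graph eE]]] := @two_realize (r * 2) k
  [:: r.-1; r; r.+1] [:: r] [:: r.-1; r; r.+1] [:: r] r r.-1 0 k
  (r * 2 + t + k * 2 + q) q (r ^ 2) kt;
  rewrite ?Mr ?Mr1 ?Mp //=;
  try by [rewrite !inE; lia | move=> i; rewrite !inE; lia | lia | move=> _ i ->].
- move=> _ i id; exists (if i < r then r.-1 else if i == r then r else r.+1).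
    by rewrite !inE; do 2?case: ifP; lia.
  by do 2?case: ifP; rewrite /maxdist; lia.
- by move=> _ i id; exists r; rewrite ?inE // /maxdist; lia.
- by move=> _; exists r.-1; rewrite ?inE ?eqxx.
- by move=> _; exists r; rewrite ?inE ?eqxx; lia.
- by move=> kt0; exists r, r; rewrite !inE !eqxx ?orbT; split=> //; lia.
- by move=> _ x y /and3P[xk yk _]; rewrite /two xk yk Mr mulnn.
exists T, e; split=> //; apply/eqP; rewrite -(eqn_pmul2r (isT : 0 < 2)) eE.
by rewrite sum_clique0 !big_cons !big_nil Mr Mr1 Mp; apply/eqP; nia.
Qed.

(** One edge between two pendant vertices at [r]; for [r = 2] this is extremal in the exceptional
    case. *)
Lemma even_pendant_edge_graph r : 1 < r -> 1 < t ->
  exists (T : finType) (e : rel T),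
    cgraph_nmd e ((r * 2).+1 + t) ((r * 2).+1 + t) (r * 2) /\
    sigma2 e = path_cost (r * 2) + t * (r * r.+1) + r.+1 ^ 2.
Proof.
move=> r1 t1; have [Mr Mr1 Mp] := maxdist_even (ltnW r1).
have [|||||||||||||||||||||||T [e [e_graph eE]]] := @two_realize (r * 2) 0
  [:: r] [:: r] [:: r] [:: r] r.-1 r.-1 0 t
  ((r * 2).+1 + t) 1 (r.+1 ^ 2) (leq0n t);
  rewrite ?Mr ?Mr1 ?Mp //=;
  try by [rewrite !inE; lia | move=> i; rewrite !inE; lia | lia | move=> _ i ->].
- by move=> _ i id; exists r; rewrite ?inE // /maxdist; lia.
- by move=> _; exists r; rewrite ?inE ?eqxx; lia.
- by move=> _ x y _; rewrite /two /= Mp mulnn.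
exists T, e; split=> //; apply/eqP; rewrite -(eqn_pmul2r (isT : 0 < 2)) eE.
by rewrite sum_clique0 !big_cons !big_nil Mr Mp; apply/eqP; nia.
Qed.

Definition crossing : rel 'I_t := fun x y => (x < 1) (+) (y < 1).

(** Fills the gap left for [r = 2] with one edge fewer than [even_tight_graph] provides at [k = 2]:
    a single vertex sees [r - 1], [r], [r + 1], and one pendant vertex is joined to it. *)
Lemma even_crossing_graph r : 1 < r -> 1 < t ->
  exists (T : finType) (e : rel T),
    cgraph_nmd e ((r * 2).+1 + t) (r * 2 + t + 3) (r * 2) /\
    sigma2 e = path_cost (r * 2) + (t + 3) * r ^ 2 + (t + 2) * r.
Proof.
move=> r1 t1; have [Mr Mr1 Mp] := maxdist_even (ltnW r1).
pose s := two 1 [:: r.-1; r; r.+1] [:: r]; pose l := two 1 r r.-1.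
have s_r x : r \in s x by rewrite /s /two; case: ifP; rewrite !inE eqxx ?orbT.
have l_le x : 2 <= maxdist (r * 2) (l x).
  by rewrite /l /two; case: ifP; rewrite ?Mr ?Mp; lia.
have crossing_sym : symmetric crossing by move=> x y; rewrite /crossing addbC.
have crossing_irr : irreflexive crossing by move=> x; rewrite /crossing addbb.
have n1 := @nedges_two (r * 2) 1 [:: r.-1; r; r.+1] [:: r] 0 (ltnW t1) (leq0n t).
rewrite -/s /= in n1.
have {}n1 : nedges (spined (d := r * 2) s (clique 0)) = r * 2 + t + 2.
  apply/eqP; rewrite -(eqn_pmul2r (isT : 0 < 2)) n1 ?inE //; first by lia.
  - by lia.
  - by move=> i; rewrite !inE; lia.
  - by move=> i; rewrite inE; lia.
have [|||||||||||||||T [e [e_graph eE]]] := @spined_realize (r * 2) t s s (clique 0)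
  crossing l (r * 2 + t + 3) (r * r.+1); rewrite ?n1 //.
- by move=> x i.
- by move=> x; rewrite /s /two; case: ifP => _ //=; rewrite !inE; lia.
- by move=> x i; rewrite /s /l /two; case: ifP => _; rewrite !inE; lia.
- by move=> x; rewrite /l /two; case: ifP; lia.
- by move=> x y _; rewrite /l /two; do 2!case: ifP; lia.
- move=> x i id; rewrite /s /l /two; case: ifP => _.
    exists (if i < r then r.-1 else if i == r then r else r.+1).
      by rewrite !inE; do 2?case: ifP; lia.
    by do 2?case: ifP; rewrite /maxdist; lia.
  by exists r; rewrite ?inE // /maxdist; lia.
- by move=> x y _; exists r, r; rewrite !s_r subnn.
- by move=> x i ->.
- move=> x y; rewrite /crossing /l /two.
  by case: (x < 1); case: (y < 1) => //= _ _; rewrite Mr Mp // mulnC.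
(* Just one edge of the star [crossing] is added, so it suffices that the star has an edge. *)
- apply/andP; split; first by lia.
  have -> : r * 2 + t + 3 = (nedges (spined (d := r * 2) s (clique 0))).+1 by rewrite n1; lia.
  apply: (@nedges_lt _ _ _ _ _ _ (inr (Ordinal (ltnW t1))) (inr (Ordinal t1))) => //.
  + exact: spined_simple (@clique_sym _ _) (@clique_irr _ _).
  + exact: spined_simple.
  + by move=> [i|x] [j|y].
exists T, e; split=> //; apply/eqP; rewrite -(eqn_pmul2r (isT : 0 < 2)) eE n1 sum_clique0.
have := sum_two [:: r.-1; r; r.+1] [:: r] r r.-1
  (fun i j => maxdist (r * 2) i * maxdist (r * 2) j) (ltnW t1).
rewrite -/s -/l /= => ->; rewrite !big_cons !big_nil Mr Mr1 Mp.
by apply/eqP; nia.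
Qed.

End Extremal.

(** * Diameter two *)

Lemma leq_card_nedges (T : finType) (e : rel T) :
  simple_graph e -> connected_graph e -> #|T| <= (nedges e).+1.
Proof.
move=> e_simple e_conn; case: (posnP #|T|) => [->//|/card_gt0P[v0 _]].
pose par u := odflt u [pick v | e u v && (dist e v v0 < dist e u v0)].
have parP u : u != v0 -> e u (par u) /\ dist e (par u) v0 < dist e u v0.
  case/(closer_neighbor e_conn) => w uw; rewrite /par; case: pickP => [v /andP[]//|].
  by move/(_ w); rewrite uw.
pose O u v := (u != v0) && (v == par u).
have := @sum_owned _ (arcs e) O (fun _ _ => 1) (arcs_sym e_simple) (fun _ _ => erefl).
rewrite sum1_card -nedgesE // mulnC leq_mul2r /=.
have -> : \sum_u \sum_(v | O u v) 1 = #|T| - 1.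
  rewrite (bigD1 v0) //= [X in X + _]big_pred0 => [|v]; last by rewrite /O eqxx.
  rewrite subn1 -(cardC1 v0) -sum1_card; apply: eq_big => [//|u uv].
  by rewrite (big_pred1 (par u)) // => v; rewrite /O uv.
move=> le_m; rewrite -add1n -leq_subLR; apply: le_m => [u v|u v].
  by case/andP=> /parP[euv _] /eqP->; rewrite in_arcs.
case/andP=> /parP[_ lt_u] /eqP->; apply/negP => /andP[/parP[_ lt_v] /eqP uE].
by rewrite -uE in lt_v; lia.
Qed.

(** [nu n k] counts the edges that meet [k] dominating vertices: their degrees add up to
    [k * (n - 1)], with the edges among them counted twice. *)
Lemma nu_double n k : k <= n -> nu n k * 2 + k * (k - 1) = 2 * k * (n - 1).
Proof. by move=> kn; have := bin2_double k; rewrite /nu; nia. Qed.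

Lemma mulnB1 x : x * (x - 1) + x = x * x.
Proof. by case: x => // x; rewrite subn1 /=; lia. Qed.

Lemma nu_complement n k : k <= n -> nu n k * 2 + (n - k) * (n - k - 1) = n * (n - 1).
Proof.
move=> kn; have := nu_double kn.
have : k * (n - 1) + k = k * n by case: n kn => [|n] kn; rewrite ?subn1 /=; lia.
have [c nE] : exists c, n = k + c by exists (n - k); lia.
have -> : n - k = c by lia.
have := mulnB1 c; have := mulnB1 k; have := mulnB1 n; rewrite -mulnA nE; lia.
Qed.

Section DiameterTwo.
Variables (T : finType) (e : rel T) (n m : nat).
Hypothesis e_graph : cgraph_nmd e n m 2.

Let e_simple : simple_graph e. Proof. by case: e_graph. Qed.
Let e_conn : connected_graph e. Proof. by case: e_graph. Qed.

Definition dominating := [set u | ecc e u <= 1].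
Let J := dominating.
Let j := #|J|.

Lemma dominating_edge u v : u \in J -> u != v -> e u v.
Proof.
rewrite inE => u1 uv; rewrite -(dist_eq1 e_conn uv).
by apply: leq_trans u1; apply: dist_le_ecc.
Qed.

Lemma diam2_ecc u : ecc e u + (u \in J) = 2.
Proof.
case: e_graph => _ _ _ _ dE.
have le2 : ecc e u <= 2 by rewrite -dE; apply: ecc_le_diam.
have gt0 : 0 < ecc e u.
  rewrite lt0n; apply/negP => /eqP u0.
  have d0 v : dist e u v = 0 by apply/eqP; rewrite -leqn0 -u0 dist_le_ecc.
  suff : diam e <= 0 by rewrite dE.
  apply/bigmax_leqP => v _; apply/bigmax_leqP => w _.
  have := dist_triangle e_conn v u w; rewrite (dist_sym e_simple.1 e_conn v u).
  by rewrite !d0.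
by rewrite inE; case: leqP; lia.
Qed.

Let sum_dominating : \sum_(p in arcs e) (p.1 \in J) = j * (n - 1).
Proof.
case: e_graph => _ _ nE _ _.
rewrite (eq_bigl (fun p => e p.1 p.2)) => [|p]; last by rewrite inE.
rewrite -(pair_big_dep xpredT e (fun u _ => nat_of_bool (u \in J))) /=.
rewrite (bigID (mem J)) /= [X in _ + X]big1 ?addn0 => [|u /negPf uJ]; last first.
  by rewrite big1 // => v _; rewrite uJ.
rewrite -sum_nat_const; apply: eq_bigr => u uJ; rewrite uJ sum1dep_card.
rewrite -nE subn1 -(cardC1 u) -[LHS]cardsE; apply: eq_card => v; rewrite !inE.
apply/idP/idP => [|vu]; last by apply: dominating_edge uJ _; rewrite eq_sym.
by apply: contraTneq => ->; rewrite e_simple.2.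
Qed.

Let sum_dominating2 : \sum_(p in arcs e) (p.2 \in J) = j * (n - 1).
Proof.
rewrite -sum_dominating (reindex_inj (inv_inj (@swapK T))) /=.
by apply: eq_bigl => -[u v]; rewrite /= (arcs_sym e_simple).
Qed.

Let sum_dominating_both : \sum_(p in arcs e) (p.1 \in J) * (p.2 \in J) = j * (j - 1).
Proof.
rewrite -card_offdiag -sum1_card big_mkcond [RHS]big_mkcond; apply: eq_bigr => -[u v] _.
rewrite in_arcs inE /=; case: (boolP (u \in J)) => uJ; last by rewrite if_same.
case: (boolP (v \in J)) => vJ; last by rewrite if_same.
case: eqVneq => [->|uv] /=; first by rewrite e_simple.2.
by rewrite dominating_edge.
Qed.

Let arcsE : #|arcs e| = m * 2.
Proof. by rewrite -nedgesE //; case: e_graph => _ _ _ ->. Qed.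

(** With [x] and [y] the indicators of [J] at the two ends, a pair contributes [(2 - x) * (2 - y) =
    4 - 2 * x - 2 * y + x * y]. *)
Lemma diam2_sigma2 : sigma2 e * 2 + 4 * j * (n - 1) = 8 * m + j * (j - 1).
Proof.
rewrite sigma2E // -sum_dominating_both.
have -> : 4 * j * (n - 1) = \sum_(p in arcs e) (2 * (p.1 \in J) + 2 * (p.2 \in J)).
  by rewrite big_split /= -!big_distrr /= sum_dominating sum_dominating2; lia.
have -> : 8 * m = \sum_(p in arcs e) 4 by rewrite sum_nat_const arcsE; lia.
rewrite -!big_split /=; apply: eq_bigr => p _.
have := diam2_ecc p.1; have := diam2_ecc p.2.
by case: (p.1 \in J); case: (p.2 \in J) => /=; nia.
Qed.

Lemma diam2_nedges : 2 * j * (n - 1) <= m * 2 + j * (j - 1).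
Proof.
have -> : 2 * j * (n - 1) = \sum_(p in arcs e) ((p.1 \in J) + (p.2 \in J)).
  by rewrite big_split /= sum_dominating sum_dominating2; lia.
rewrite -sum_dominating_both -arcsE -sum1_card -big_split /=.
by apply: leq_sum => p _; case: (p.1 \in J); case: (p.2 \in J).
Qed.

Lemma diam2_card_dominating : j <= n.
Proof. by case: e_graph => _ _ <- _ _; apply: max_card. Qed.

Lemma diam2_not_complete : m * 2 < n * (n - 1).
Proof.
case: e_graph => _ _ nE _ dE.
have [|u [v duv]] := @diam_attained T e.
  by rewrite lt0n; apply: contra_eqN dE => /eqP/fintype0 T0; rewrite /diam big_pred0.
rewrite dE in duv; rewrite -arcsE -nE -cardsT -card_offdiag; apply/proper_card/properP.
split; first apply/subsetP => -[x y].
  rewrite in_arcs !inE /= => exy.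
  by apply: contraTneq exy => ->; rewrite e_simple.2.
have uv : u != v by apply: contra_eqN duv => /eqP->; rewrite dist_refl.
exists (u, v); first by rewrite !inE.
by rewrite in_arcs -(dist_eq1 e_conn uv) duv.
Qed.

Lemma diam2_index k : nu n k <= m < nu n k.+1 -> [/\ 0 < k, k.+2 <= n & j <= k].
Proof.
move=> /andP[le_m lt_m]; have nc := diam2_not_complete.
have := leq_card_nedges e_simple e_conn; case: (e_graph) => _ _ -> -> _ nm.
have k_gt0 : 0 < k.
  by rewrite lt0n; apply/negP => /eqP k0; move: lt_m (bin2_double 1); rewrite k0 /nu; lia.
have kn : k.+2 <= n.
  rewrite leqNgt; apply/negP => nk; have := bin2_double k; move: le_m; rewrite /nu.
  (* For [k] at least [n] the truncated [n - k] is 0; for [n = k + 1] too, [nu n k] is the size of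
     the complete graph, which has diameter below 2. *)
  case: (leqP n k) => [nk'|kn] le_m bk; first by have := leq_mul nk' (leq_sub2r 1 nk'); lia.
  have nE : n = k.+1 by lia.
  have kkE : k * (k - 1) + k * 2 = k.+1 * k by case: (k) => // i; rewrite subn1 /=; lia.
  by rewrite nE subn1 subSnn /= in nc le_m; lia.
split=> //; rewrite leqNgt; apply/negP => kj.
have := nu_double (ltnW kn); have := diam2_nedges; have := diam2_card_dominating.
move: kj lt_m; move: (j) => i; set v := nu n k.+1.
move=> ki mv iN le1 le2; have [c iE] : exists c, i = k.+1 + c by [exists (i - k.+1); lia].
have [N nE] : exists N, n = N.+1 by [exists n.-1; lia].
(* Says that [2 * i * N - i * (i - 1)] does not decrease from [k + 1] to [k + 1 + c]. *)
have : c * (2 * k + 1 + c) <= c * (2 * N) by rewrite leq_mul2l; lia.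
by move: le1 le2; rewrite iE nE !subn1 addSn /=; lia.
Qed.

End DiameterTwo.

Lemma bound_d2_double n m k : k <= n -> nu n k <= m ->
  bound_d2 n m k * 2 + 4 * k * (n - 1) = 8 * m + k * (k - 1).
Proof.
move=> kn km; have bk := bin2_double k; have vk := nu_double kn; rewrite /bound_d2.
have : k * (n - k) + k * (k - 1) = k * (n - 1).
  by rewrite -mulnDr; case: (k) kn => // i kn; congr (_ * _); lia.
by rewrite -!mulnA in vk *; lia.
Qed.

(** For fixed [n] and [m] the value in [diam2_sigma2] decreases in the number of dominating
    vertices, and that number is at most [k]. *)
Lemma diam2_lower (T : finType) (e : rel T) n m k :
  cgraph_nmd e n m 2 -> nu n k <= m < nu n k.+1 -> bound_d2 n m k <= sigma2 e.
Proof.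
move=> e_graph km; have [k0 kn jk] := diam2_index e_graph km.
have sE := diam2_sigma2 e_graph; have bE := @bound_d2_double n m k ltac:(lia) (andP km).1.
rewrite -(leq_pmul2r (isT : 0 < 2)) -(leq_add2r (4 * k * (n - 1))) bE.
have [c kE] : exists c, k = #|dominating e| + c by exists (k - #|dominating e|); lia.
move: sE kE kn; move: #|dominating e| (sigma2 e) => j s sE kE kn.
have [N nE] : exists N, n = N.+1 by exists n.-1; lia.
have : c * (2 * j + c) <= c * (2 * N + 1) by rewrite leq_mul2l; lia.
by have := mulnB1 j; have := mulnB1 k; move: sE; rewrite kE nE !subn1 /=; lia.
Qed.

Lemma diam2_graph n m k : 0 < k -> k.+2 <= n -> nu n k <= m < nu n k.+1 ->
  exists (T : finType) (e : rel T), cgraph_nmd e n m 2 /\ sigma2 e = bound_d2 n m k.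
Proof.
move=> k0 kn km; have /andP[le_m lt_m] := km.
pose e1 : rel 'I_n := fun x y => (x != y) && ((x < k) || (y < k)).
pose e2 : rel 'I_n := fun x y => x != y.
have e1_simple : simple_graph e1.
  by split=> [x y|x]; rewrite /e1 ?eqxx // eq_sym orbC.
have e2_simple : simple_graph e2 by split=> [x y|x]; rewrite /e2 ?eqxx // eq_sym.
have e12 : subrel e1 e2 by move=> x y /andP[].
have nuk := @nu_complement n k ltac:(lia); have nuk1 : nu n k.+1 * 2 <= n * (n - 1).
  by rewrite -(@nu_complement n k.+1) ?leq_addr //; lia.
have n2 : nedges e2 * 2 = n * (n - 1).
  have := card_offdiag [set: 'I_n]; rewrite cardsT card_ord => <-.
  by rewrite nedgesE //; apply: eq_card => p; rewrite !inE.
have n1 : nedges e1 * 2 = n * (n - 1) - (n - k) * (n - k - 1).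
  pose X : {set 'I_n} := [set x : 'I_n | k <= x].
  have XE : #|X| = n - k.
    rewrite -sum1dep_card big_mkcond /=.
    rewrite (eq_bigr (fun x : 'I_n => if x < k then 0 else 1)).
      by rewrite sum_first; lia.
    by move=> x _; rewrite ltnNge; case: leqP.
  rewrite nedgesE // -n2 nedgesE // -XE -card_offdiag -(cardsID [set p : 'I_n * 'I_n |
    [&& p.1 \in X, p.2 \in X & p.1 != p.2]] (arcs e2)).
  rewrite (setIidPr _) ?addKn.
    by apply: eq_card => -[x y]; rewrite !inE /= /e1 /e2 !ltnNge; case: eqVneq => _ /=;
       rewrite ?andbF // !andbT negb_and.
  by apply/subsetP => -[x y]; rewrite !inE => /and3P[].
have [|e [e_simple e1e ee2 eE]] := @intermediate_graph _ e1 e2 e1_simple e2_simple e12 m.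
  by rewrite -(leq_pmul2r (isT : 0 < 2)) -[X in _ && X](leq_pmul2r (isT : 0 < 2)) n1 n2; lia.
have k_dom (x y : 'I_n) : x < k -> x != y -> e x y.
  by move=> xk xy; apply: e1e; rewrite /e1 xy xk.
have n0 : 0 < n by lia.
pose o := Ordinal n0.
have reach x y : exists2 i, i <= 2 & walkb e x y i.
  case: (eqVneq x o) => [->|xo].
    case: (eqVneq o y) => [->|oy]; first by exists 0; rewrite ?walkb0.
    by exists 1 => //; apply/walkb1/k_dom.
  have xo1 : walkb e x o 1 by apply/walkb1; rewrite e_simple.1 k_dom // eq_sym.
  case: (eqVneq o y) => [<-|oy]; first by exists 1.
  by exists 2 => //; apply: (walkb_cat xo1); apply/walkb1/k_dom.
have e_conn : connected_graph e.
  move=> x y; have [i _ /walkbP[p [ep lp _]]] := reach x y.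
  by apply/connectP; exists p.
have diam2 : diam e = 2.
  apply/eqP; rewrite eqn_leq; apply/andP; split.
    apply/bigmax_leqP => x _; apply/bigmax_leqP => y _.
    by have [i le2 /dist_le le_i] := reach x y; apply: leq_trans le2.
  rewrite ltnNge; apply/negP => diam1.
  suff : nedges e * 2 = n * (n - 1) by rewrite eE; lia.
  rewrite -n2; congr (_ * 2); apply/eqP; rewrite -(eqn_pmul2r (isT : 0 < 2)) !nedgesE //.
  apply/eqP/eq_card => -[x y]; rewrite !in_arcs; apply/idP/idP; first exact: ee2.
  by move=> xy; rewrite -(dist_eq1 e_conn xy) (leq_trans (dist_le_diam e x y)).
have e_graph : cgraph_nmd e n m 2 by split; rewrite // card_ord.
exists 'I_n, e; split=> //.
(* The edges added among the last [n - k] vertices create no further dominating vertex, as [m] is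
   below [nu n k.+1]. *)
have [_ _ jk] := diam2_index e_graph km.
have kj : k <= #|dominating e|.
  have kE : #|[set x : 'I_n | x < k]| = k.
    by rewrite -sum1dep_card big_mkcond /= sum_first; lia.
  rewrite -{1}kE; apply/subset_leq_card/subsetP => x; rewrite !inE => xk.
  apply/bigmax_leqP => y _; case: (eqVneq x y) => [->|xy]; first by rewrite dist_refl.
  by apply/dist_le/walkb1/k_dom.
have {jk kj} jE : #|dominating e| = k by apply/eqP; rewrite eqn_leq jk.
have := diam2_sigma2 e_graph; rewrite jE -(@bound_d2_double n m k) //; last by lia.
by move=> /addIn/eqP; rewrite eqn_pmul2r // => /eqP.
Qed.

Lemma diam1_sigma2 (T : finType) (e : rel T) n m : cgraph_nmd e n m 1 -> sigma2 e = m.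
Proof.
case=> e_simple e_conn _ <- dE; apply/eqP.
rewrite -(eqn_pmul2r (isT : 0 < 2)) sigma2E // nedgesE // -sum1_card.
apply/eqP/eq_bigr => -[u v]; rewrite in_arcs /= => uv.
have ecc1 x y : e x y -> ecc e x = 1.
  move=> exy; have xy : x != y by apply: contraTneq exy => ->; rewrite e_simple.2.
  have := dist_gt0 e_conn xy; have := dist_le_ecc e x y; have := ecc_le_diam e x.
  by rewrite dE; lia.
by rewrite (ecc1 _ _ uv) (ecc1 v u) // e_simple.1.
Qed.

(** * Odd diameter: bounds and attainment *)

Lemma bound_oddE n m r : (r * 2).+1 <= m ->
  bound_odd n m (r * 2).+1 =
  (path_cost (r * 2).+1 + (m - (r * 2).+1) * r.+1 ^ 2)%:R%R.
Proof.
move=> dm; have := congr1 (fun x => (x%:R : rat)%R) (path_cost_odd r).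
rewrite /bound_odd !(natrD, natrX, natrM) natrB //.
have -> : ((r * 2).+1%:R = 2 * r%:R + 1 :> rat)%R by rewrite -addn1 natrD natrM; ring.
have -> : (r.+1%:R = r%:R + 1 :> rat)%R by rewrite -addn1 natrD.
move: ((path_cost _)%:R)%R (r%:R : rat)%R (m%:R : rat)%R => c x y cE.
have -> : (c = (7 * (2 * x + 1) ^+ 3 - (2 * x + 1) + 6) / 12)%R by lra.
by field.
Qed.

Lemma bound_evenE n m r k : r * 2 <= m -> r * 2 < n ->
  bound_even n m (r * 2) k =
  (path_cost (r * 2) + (m - r * 2) * r ^ 2 + (n - 1 - r * 2 + k) * r)%:R%R.
Proof.
move=> dm dn; have := congr1 (fun x => (x%:R : rat)%R) (path_cost_even r).
rewrite /bound_even !(natrD, natrX, natrM) !natrB ?natrM; try lia.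
move: ((path_cost _)%:R)%R (r%:R : rat)%R (m%:R : rat)%R => c x y cE.
have -> : (c = (7 * (x * 2) ^+ 3 - 4 * (x * 2)) / 12)%R by lra.
by field.
Qed.

Lemma odd_min_mid n m r : let d := (r * 2).+1 in
  2 * n - 2 - d <= m <= 'C(n - d, 2) + n - 1 -> min_sigma2_is n m d (bound_odd n m d).
Proof.
move=> d m_range; split=> [T e e_graph|[T [e e_graph]]];
  have [B [dn dm le_s _ _]] := @odd_lower T e n m d e_graph r.+1 (erefl _);
  rewrite bound_oddE //.
  by have := leq0n (r.+1 * B); rewrite ler_nat -(leq_pmul2r (isT : 0 < 2)) -/d; lia.
(* For [d = 1] all eccentricities are 1, and the given graph itself attains the bound. *)
have [r0|r_gt0] := posnP r.
  exists T, e; split=> //; congr (_%:R)%R; rewrite /d r0 in e_graph dm *.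
  by rewrite (diam1_sigma2 e_graph) /path_cost big_ord_recl big_ord0 /maxdist /=; lia.
have [t nE] : exists t, n = (r * 2).+2 + t by exists (n - d - 1); rewrite /d in dn *; lia.
have ndE : n - d = t.+1 by rewrite /d; lia.
have := bin2_double t.+1; rewrite ndE subn1 /= in m_range * => bin1.
have [|T' [e' [e'_graph sE]]] := @odd_mid_graph t r (m - d - t * 2) r_gt0.
  by have := mulnB1 t; rewrite /d in m_range *; lia.
rewrite -nE (_ : (r * 2).+1 + t * 2 + (m - d - t * 2) = m) in e'_graph;
  last by rewrite /d in m_range *; lia.
exists T', e'; split=> //; rewrite sE; congr (_%:R)%R; congr (_ + _ * _).
by rewrite /d in m_range *; lia.
Qed.

Lemma bound_odd_outerE n m r k : (r * 2).+1 <= m ->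
  (bound_odd n m (r * 2).+1 + k%:R * ((r * 2).+1%:R + 1) / 2)%R =
  (path_cost (r * 2).+1 + (m - (r * 2).+1) * r.+1 ^ 2 + k * r.+1)%:R%R.
Proof.
move=> dm; rewrite bound_oddE // [RHS]natrD; congr (_ + _)%R; rewrite natrM.
have -> : ((r * 2).+1%:R = 2 * r%:R + 1 :> rat)%R by rewrite -addn1 natrD natrM; ring.
have -> : (r.+1%:R = r%:R + 1 :> rat)%R by rewrite -addn1 natrD.
by field.
Qed.

Lemma odd_outer_lower (T : finType) (e : rel T) n m r k : let d := (r * 2).+1 in
  k <= n - d - 1 -> m = 2 * n - 2 - d - k \/ m = 'C(n - d, 2) + n - 1 + k ->
  cgraph_nmd e n m d ->
  path_cost d + (m - d) * r.+1 ^ 2 + k * r.+1 <= sigma2 e.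
Proof.
move=> d kt mE e_graph.
have [B [dn dm le_s low high]] := @odd_lower T e n m d e_graph r.+1 (erefl _).
have B2k : k * 2 <= B.
  have [t nE] : exists t, n = d + t.+1 by exists (n - d - 1); lia.
  have := bin2_double (n - d); have ndE : n - d = t.+1 by lia.
  rewrite ndE !subn1 -!mulnn /= in kt mE high low * => bin1.
  by case: mE => mE; lia.
have := leq_mul (leqnn r.+1) B2k.
by rewrite -(leq_pmul2r (isT : 0 < 2)); lia.
Qed.

Lemma odd_min_outer n m r k : let d := (r * 2).+1 in
  1 <= k <= n - d - 1 -> m = 2 * n - 2 - d - k \/ m = 'C(n - d, 2) + n - 1 + k ->
  min_sigma2_is n m d (bound_odd n m d + k%:R * (d%:R + 1) / 2)%R.
Proof.
move=> d /andP[k0 kt] mE; split=> [T e e_graph|[T [e e_graph]]];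
  have [B [dn dm _ _ _]] := @odd_lower T e n m d e_graph r.+1 (erefl _);
  have lower := @odd_outer_lower T e n m r k kt mE e_graph;
  rewrite bound_odd_outerE //.
  by rewrite ler_nat.
(* For [d = 1] the index equals [m], which contradicts [lower] because [k] is positive: no such
   graph exists. *)
have [r0|r_gt0] := posnP r.
  rewrite /d r0 in e_graph dm lower; rewrite (diam1_sigma2 e_graph) in lower.
  by rewrite /path_cost big_ord_recl big_ord0 /maxdist /= in lower; lia.
have [t nE] : exists t, n = (r * 2).+2 + t by exists (n - d - 1); rewrite /d in dn *; lia.
have ndE : n - d = t.+1 by rewrite /d; lia.
have kt' : k <= t by lia.
case: mE => mE.
  have [T' [e' [e'_graph sE]]] := odd_low_graph r_gt0 kt'.
  have mE' : m = (r * 2).+1 + t + (t - k) by rewrite /d in mE; lia.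
  rewrite -nE -mE' in e'_graph; exists T', e'; split=> //; rewrite sE.
  by congr (_%:R)%R; congr (_ + _ * _ + _); lia.
have [T' [e' [e'_graph sE]]] := odd_high_graph r_gt0 kt'.
have mE' : m = (r * 2).+1 + t * 2 + 'C(t, 2) + k.
  rewrite mE ndE; have := bin2_double t.+1; have := bin2_double t.
  by have := mulnB1 t; rewrite subn1 /=; lia.
rewrite -nE -mE' in e'_graph; exists T', e'; split=> //; rewrite sE.
by congr (_%:R)%R; congr (_ + _ * _ + _); lia.
Qed.

(** * Even diameter at least four *)

Section EvenDiameter.
Variables (n m r k : nat).
Hypothesis r_gt1 : 1 < r.
Hypothesis k_least : forall j, j < k -> mu n j < m.

Lemma mu_prev : 0 < k -> n + 'C(k, 2) + k <= m.+1.
Proof.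
case: k k_least => // i /(_ i (leqnn _)) + _; rewrite /mu.
have := bin2_double i.+1; have := bin2_double i; have := mulnB1 i.
by rewrite subn1 /=; lia.
Qed.

Lemma even_bound (T : finType) (e : rel T) : cgraph_nmd e n m (r * 2) ->
  [/\ r * 2 < n, r * 2 <= m &
   path_cost (r * 2) + (m - r * 2) * r ^ 2 + (n - 1 - r * 2 + k) * r <= sigma2 e].
Proof.
move=> e_graph; have d_gt0 : 0 < r * 2 by lia.
have [B [s [[dn dm le_s low high] _]]] := @even_lower T e n m (r * 2) e_graph r d_gt0 (erefl _).
(* Otherwise ownership gives [s < k], so at most [k * (k - 1)] pairs are good, too few for [m] to
   exceed [mu n (k - 1)]. *)
split=> //; have Bk : (n - 1 - r * 2 + k) * 2 <= B.
  rewrite leqNgt; apply/negP => lt_B; have sk : s < k by lia.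
  have := mu_prev (leq_ltn_trans (leq0n s) sk).
  have : s * s.+1 <= (k - 1) * k by apply: leq_mul; lia.
  by have := bin2_double k; rewrite [k * _]mulnC; lia.
have := leq_mul (leqnn r) Bk.
by rewrite -(leq_pmul2r (isT : 0 < 2)); lia.
Qed.

Hypothesis m_le : m <= mu n k.

Lemma even_attained (T : finType) (e : rel T) : cgraph_nmd e n m (r * 2) ->
  ~~ [&& r * 2 == 4, m == n & 7 <= n] ->
  exists (T' : finType) (e' : rel T'), cgraph_nmd e' n m (r * 2) /\
    sigma2 e' = path_cost (r * 2) + (m - r * 2) * r ^ 2 + (n - 1 - r * 2 + k) * r.
Proof.
move=> e_graph not_exc; have d_gt0 : 0 < r * 2 by lia.
have [B [s [[dn dm _ _ _] m_max]]] := @even_lower T e n m (r * 2) e_graph r d_gt0 (erefl _).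
have nm : n <= m.+1.
  by case: (e_graph) => e_simple e_conn <- <- _; apply: leq_card_nedges.
have [t nE] : exists t, n = (r * 2).+1 + t by exists (n - 1 - r * 2); lia.
have tE : n - r * 2 - 1 = t by lia.
have tE' : n - 1 - r * 2 = t by lia.
rewrite tE -mulnn in m_max; rewrite tE'.
(* [mu n t] equals the maximal number of edges given by [m_max], so it cannot be less than [m]. *)
have kt : k <= t.
  rewrite leqNgt; apply/negP => /k_least; rewrite /mu.
  by have := bin2_double t; have := mulnB1 t; lia.
(* By the choice of [k], this number of optional edges lies between ['C(k, 2)] and
   ['C(k, 2) + k]. *)
pose q := m - (r * 2 + t + k).
have prev := mu_prev; have := bin2_double k; have := mulnB1 k; have m_le' := m_le.
rewrite /mu in m_le' => kk bk.
have mE : m = r * 2 + t + k + q.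
  by rewrite /q subnKC //; case: posnP prev => [->|_ /(_ isT)]; lia.
have mE' : m - r * 2 = t + k + q by lia.
rewrite mE'; have [loose|] := boolP ((2 < r) || (k == t)).
  have [|T' [e' [e'_graph sE]]] := even_loose_graph (q := q) r_gt1 kt loose.
    by rewrite mulnS; lia.
  by exists T', e'; rewrite nE mE; split=> //; rewrite sE; lia.
rewrite negb_or -leqNgt => /andP[r2 kNt]; have {r2} rE : r = 2 by lia.
(* Here [d = 4] and [k < t]. If [q < k], then ['C(k, 2) <= q] leaves [k = 1], [q = 0], the excluded
   case [m = n], and [k = 2], [q = 1], the crossing graph. *)
have [kq|qk] := leqP k q.
  have [|T' [e' [e'_graph sE]]] := even_tight_graph (q := q - k) r_gt1 kt; first by lia.
  have qE : t + k * 2 + (q - k) = t + k + q by lia.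
  rewrite qE in sE; exists T', e'; rewrite nE mE; split; last by rewrite sE; lia.
  by rewrite -(_ : r * 2 + t + k * 2 + (q - k) = r * 2 + t + k + q) //; lia.
have k_gt0 : 0 < k by lia.
have {}prev := prev k_gt0; have k_lt3 : k < 3.
  rewrite ltnNge; apply/negP => k3; have := leq_mul (leqnn k) (_ : 2 <= k - 1).
  by move/(_ ltac:(lia)); lia.
have k2 : k = 2.
  have [//|k1] : k = 2 \/ k = 1 by lia.
  by move: not_exc; rewrite rE /=; move: kNt bk; rewrite k1; lia.
have q1 : q = 1 by move: bk; rewrite k2 in prev qk *; lia.
have [|T' [e' [e'_graph sE]]] := even_crossing_graph (t := t) r_gt1; first by lia.
exists T', e'; rewrite nE mE k2 q1; split; last by rewrite sE; lia.
by rewrite -addnA.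
Qed.

End EvenDiameter.

Lemma even_exceptional n k : 7 <= n -> n <= mu n k -> (forall j, j < k -> mu n j < n) ->
  min_sigma2_is n n 4 (bound_even n n 4 k + 3)%R.
Proof.
move=> n7 n_le k_least; have k1 : k = 1.
  case: k n_le k_least => [|[|k]] //; first by rewrite /mu; have := bin2_double 0; lia.
  by move=> _ /(_ 1 isT); rewrite /mu; have := bin2_double 1; lia.
have -> : (bound_even n n 4 k + 3 = (6 * n + 15)%:R)%R.
  rewrite (@bound_evenE n n 2 k) -?natrD; try lia.
  by congr (_%:R)%R; rewrite /path_cost !big_ord_recr big_ord0 /maxdist /= k1; lia.
split=> [T e e_graph|_]; first by rewrite ler_nat; apply: unicyclic_diam4_lower e_graph n7.
have [||T [e [e_graph sE]]] := @even_pendant_edge_graph (n - 5) 2; try lia.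
have nE : 5 + (n - 5) = n by lia.
rewrite nE in e_graph; exists T, e; split=> //; rewrite sE; congr (_%:R)%R.
by rewrite /path_cost !big_ord_recr big_ord0 /maxdist /=; lia.
Qed.

Theorem theorem3p2 :
  (* (1), middle range *)
  (forall n m d : nat, odd d ->
     (2 * n - 2 - d <= m <= 'C(n - d, 2) + n - 1)%N ->
     min_sigma2_is n m d (bound_odd n m d)) /\
  (* (1), outer ranges *)
  (forall n m d k : nat, odd d -> (1 <= k <= n - d - 1)%N ->
     (m = 2 * n - 2 - d - k \/ m = 'C(n - d, 2) + n - 1 + k)%N ->
     min_sigma2_is n m d
       (bound_odd n m d + k%:R * (d%:R + 1) / 2)%R) /\
  (* (2) *)
  (forall n m d k : nat, ~~ odd d -> (4 <= d)%N ->
     (m <= mu n k)%N -> (forall j, (j < k)%N -> (mu n j < m)%N) ->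
     (forall (T : finType) (e : rel T), cgraph_nmd e n m d ->
        (bound_even n m d k <= (sigma2 e)%:R)%R) /\
     (if [&& d == 4, m == n & 7 <= n]%N
      then min_sigma2_is n m d (bound_even n m d k + 3)%R
      else min_sigma2_is n m d (bound_even n m d k))) /\
  (* (3) *)
  (forall n m k : nat, (nu n k <= m < nu n k.+1)%N ->
     min_sigma2_is n m 2 (bound_d2 n m k)%:R).
Proof.
split; [|split; [|split]].
- by move=> n m d d_odd; rewrite -[d]odd_double_half d_odd add1n -muln2; apply: odd_min_mid.
- by move=> n m d k d_odd; rewrite -[d]odd_double_half d_odd add1n -muln2; apply: odd_min_outer.
- move=> n m d k d_even d4; have dE : d = d./2 * 2.
    by rewrite muln2 -[LHS]odd_double_half (negPf d_even).
  rewrite dE in d4 *; move: d./2 d4 => r d4 m_le k_least; have r_gt1 : 1 < r by lia.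
  have lower (T : finType) (e : rel T) (e_graph : cgraph_nmd e n m (r * 2)) :
      (bound_even n m (r * 2) k <= (sigma2 e)%:R)%R.
    have [dn dm le_s] := even_bound r_gt1 k_least e_graph.
    by rewrite bound_evenE // ler_nat.
  split=> //; case: ifPn => [/and3P[/eqP d4' /eqP mn n7]|not_exc].
    by rewrite d4' mn in m_le k_least *; apply: even_exceptional.
  split=> // -[T [e e_graph]].
  have [dn dm _] := even_bound r_gt1 k_least e_graph.
  have [T' [e' [e'_graph sE]]] := even_attained r_gt1 k_least m_le e_graph not_exc.
  by exists T', e'; split=> //; rewrite sE bound_evenE.
- move=> n m k km; split=> [T e e_graph|[T [e e_graph]]].
    by rewrite ler_nat; apply: diam2_lower e_graph km.
  have [k0 kn _] := diam2_index e_graph km.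
  by have [T' [e' [e'_graph sE]]] := diam2_graph k0 kn km; exists T', e'; rewrite sE.
Qed.
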